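(* Let $P$ be a finite poset, regarded as a category with a unique arrow $p\to q$ whenever $p\le q$. Let $K:P\to\mathcal{S}$ be a diagram of topological spaces and let $X:P\to\mathcal{P}_{<\infty}$ be a diagram of finite posets, where each $X_p$ is viewed as a finite topological space. Let $\phi:K\to X$ be a morphism of diagrams (a family of continuous maps $\phi_p:K_p\to X_p$ commuting with the transition maps) such that $\phi_p$ is a weak homotopy equivalence for every $p\in P$. Then there exists a weak homotopy equivalence $$\hat\phi:\operatorname{hocolim} K\to \operatorname{\underline{hocolim}} X.$$
   Context: $\mathcal{S}$ is the category of topological spaces and $\mathcal{P}_{<\infty}$ the category of finite posets and order-preserving maps. A finite poset is viewed as a finite topological space whose open sets are the down-sets; order-preserving maps are exactly the continuous maps. A weak homotopy equivalence is a continuous map inducing isomorphisms on all homotopy groups (for all base points). For a diagram $X$ write $X_p=X(p)$ and $g_{pq}=X(p\to q)$ for $p\le q$. The non-Hausdorff homotopy colimit $\operatorname{\underline{hocolim}} X$ is the finite poset (= finite space) with underlying set $\coprod_{p\in P}X_p$, keeping the order inside each $X_p$, and for $x\in X_p$, $y\in X_q$ with $p\le q$ setting $x\le y$ iff $g_{pq}(x)\le y$ in $X_q$ (the Grothendieck construction). $\operatorname{hocolim} K$ denotes the usual (Bousfield–Kan) homotopy colimit in $\mathcal{S}$, which can be constructed as $\coprod_{p\in P}K_p\times\mathcal{K}(F_p)$ modulo the relation identifying $(\alpha,\beta)\in K_p\times \mathcal{K}(F_p)$ with $(K(p\to p')(\alpha),\beta)\in K_{p'}\times\mathcal{K}(F_{p'})$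 when $\beta\in\mathcal{K}(F_{p'})$, $p\le p'$; here $F_p=\{r\in P: r\ge p\}$ and $\mathcal{K}(Q)$ is the order complex of a poset $Q$ (the simplicial complex of nonempty chains). *)

(* Defs.v *)
From HB Require Import structures.
From mathcomp Require Import all_boot all_order all_algebra.
From mathcomp Require Import all_classical all_reals all_analysis.
From mathcomp Require Import generic_quotient.
From Stdlib Require Import Relation_Operators.

Set Implicit Arguments.
Unset Strict Implicit.
Unset Printing Implicit Defensive.

Import Order.TTheory GRing.Theory Num.Theory.
Import numFieldTopology.Exports.
Local Open Scope classical_set_scope.
Local Open Scope quotient_scope.

Definition downtop (T : choiceType) (le : rel T) : Type := T.

HB.instance Definition _ (T : choiceType) (le : rel T) :=
  Choice.on (downtop le).

Definition down_open (T : choiceType) (le : rel T) (A : set (downtop le)) :=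
  forall x y : T, le y x -> A x -> A y.

Lemma down_openT (T : choiceType) (le : rel T) : down_open (@setT (downtop le)).
Proof. by []. Qed.

Lemma down_openI (T : choiceType) (le : rel T) : setI_closed (@down_open T le).
Proof. by move=> A B oA oB x y yx [Ax Bx]; split; [exact: oA yx Ax|exact: oB yx Bx]. Qed.

Lemma down_open_bigU (T : choiceType) (le : rel T) (I : Type)
  (f : I -> set (downtop le)) : (forall i, down_open (f i)) ->
  down_open (\bigcup_i f i).
Proof. by move=> oF x y yx [i _ fxi]; exists i => //; exact: oF yx fxi. Qed.

HB.instance Definition _ (T : choiceType) (le : rel T) :=
  isOpenTopological.Build (downtop le) (@down_openT T le) (@down_openI T le)
    (@down_open_bigU T le).

Definition finspace (d : Order.disp_t) (Q : finPOrderType d) : topologicalType :=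
  downtop (<=%O : rel Q).

Local Open Scope ring_scope.

Definition unit_int (R : realType) : set R := [set r | 0 <= r <= 1].

Definition cube (R : realType) (n : nat) : topologicalType :=
  {ptws 'I_n -> set_type (@unit_int R)}.

Definition cube_bdry (R : realType) (n : nat) (c : cube R n) : Prop :=
  exists i : 'I_n, val (c i) = 0 \/ val (c i) = 1.

(* Representatives of elements of pi_n(T, x): continuous maps
   (I^n, boundary) -> (T, x). For n = 0 this is just a point of T. *)
Definition based_cube_map (R : realType) (T : topologicalType) (n : nat)
  (x : T) (f : cube R n -> T) : Prop :=
  continuous f /\ (forall c, cube_bdry c -> f c = x).

(* Homotopy relative to the boundary of the cube (for n = 0 this is
   the relation "joined by a path"). *)
Definition homotopic_rel_bdry (R : realType) (T : topologicalType) (n : nat)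
  (x : T) (f g : cube R n -> T) : Prop :=
  exists H : (set_type (@unit_int R) * cube R n)%type -> T,
    [/\ continuous H,
        (forall t c, val t = 0 -> H (t, c) = f c),
        (forall t c, val t = 1 -> H (t, c) = g c) &
        (forall t c, cube_bdry c -> H (t, c) = x)].

(* f : T -> U is a weak homotopy equivalence: f is continuous, and for
   every base point x and every n the induced map
   pi_n(T, x) -> pi_n(U, f x), [h] |-> [f o h], is a bijection (surjective
   and injective on homotopy classes); moreover pi_0(T) -> pi_0(U) is
   surjective (which covers the case of an empty T). *)
Definition weak_homotopy_equivalence (R : realType) (T U : topologicalType)
  (f : T -> U) : Prop :=
  [/\ continuous f,
      (forall y : U, exists x : T,
          @homotopic_rel_bdry R U 0 y (fun=> f x) (fun=> y)) &
      (forall (n : nat) (x : T),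
        (forall g : cube R n -> U, based_cube_map (f x) g ->
           exists h : cube R n -> T, based_cube_map x h /\
             homotopic_rel_bdry (f x) (f \o h) g) /\
        (forall h1 h2 : cube R n -> T, based_cube_map x h1 ->
           based_cube_map x h2 ->
           homotopic_rel_bdry (f x) (f \o h1) (f \o h2) ->
           homotopic_rel_bdry x h1 h2))].

Record top_diagram (d : Order.disp_t) (P : porderType d) := TopDiagram {
  tobj : P -> topologicalType;
  tmap : forall p q : P, (p <= q)%O -> tobj p -> tobj q;
  tmap_cont : forall p q (h : (p <= q)%O), continuous (tmap h);
  tmap_id : forall p (h : (p <= p)%O) x, tmap h x = x;
  tmap_comp : forall p q r (h1 : (p <= q)%O) (h2 : (q <= r)%O)
    (h3 : (p <= r)%O) x, tmap h2 (tmap h1 x) = tmap h3 x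
}.

Record poset_diagram (d : Order.disp_t) (P : porderType d) (dX : Order.disp_t)
  := PosetDiagram {
  pobj : P -> finPOrderType dX;
  pmap : forall p q : P, (p <= q)%O -> pobj p -> pobj q;
  pmap_mono : forall p q (h : (p <= q)%O), {homo pmap h : x y / (x <= y)%O};
  pmap_id : forall p (h : (p <= p)%O) x, pmap h x = x;
  pmap_comp : forall p q r (h1 : (p <= q)%O) (h2 : (q <= r)%O)
    (h3 : (p <= r)%O) x, pmap h2 (pmap h1 x) = pmap h3 x
}.

Arguments tobj {d P} t p : rename.
Arguments tmap {d P} t {p q} _ _ : rename.
Arguments pobj {d P dX} p _ : rename.
Arguments pmap {d P dX} p {p0 q} _ _ : rename.

Record diagram_morphism (d : Order.disp_t) (P : porderType d)
  (dX : Order.disp_t) (K : top_diagram P) (X : poset_diagram P dX) :=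
  DiagramMorphism {
  dmor : forall p : P, tobj K p -> finspace (pobj X p);
  dmor_cont : forall r : P, continuous (@dmor r);
  dmor_nat : forall p q (h : (p <= q)%O) (x : tobj K p),
    @dmor q (@tmap _ _ K p q h x) = @pmap _ _ _ X p q h (@dmor p x)
}.

(* Geometric realization of order complexes.                          *)
(* |K(Q)| for Q a subset of the finite poset P: barycentric coordinates *)
(* t : P -> R supported on a chain contained in Q, with the subspace   *)
(* topology of R^P (for a finite complex this is the usual topology).  *)

Definition order_complex_point (R : realType) (d : Order.disp_t)
  (P : finPOrderType d) (Q : set P) (t : P -> R) : Prop :=
  [/\ (forall r, 0 <= t r),
      \sum_(r : P) t r = 1,
      (forall r, t r != 0 -> Q r) &
      (forall r s, t r != 0 -> t s != 0 -> (r <= s)%O || (s <= r)%O)].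

Definition upset (d : Order.disp_t) (P : porderType d) (p : P) : set P :=
  [set r | (p <= r)%O].

Definition realization_F (R : realType) (d : Order.disp_t)
  (P : finPOrderType d) (p : P) : topologicalType :=
  set_type [set t : {ptws P -> R} | order_complex_point (upset p) t].

Definition hocolim_pre (R : realType) (d : Order.disp_t) (P : finPOrderType d)
  (K : top_diagram P) : topologicalType :=
  {p : P & (tobj K p * realization_F R p)%type}.

Definition hocolim_step (R : realType) (d : Order.disp_t) (P : finPOrderType d)
  (K : top_diagram P) (u v : hocolim_pre R K) : Prop :=
  exists h : (tag u <= tag v)%O,
    tmap K h (tagged u).1 = (tagged v).1 /\
    (val (tagged u).2 : P -> R) = val (tagged v).2.

Definition hocolim_rel (R : realType) (d : Order.disp_t) (P : finPOrderType d)
  (K : top_diagram P) : rel (hocolim_pre R K) :=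
  fun u v => `[< clos_refl_sym_trans _ (@hocolim_step R d P K) u v >].

Lemma hocolim_rel_refl R d P K : reflexive (@hocolim_rel R d P K).
Proof. by move=> u; apply/asboolP; apply: rst_refl. Qed.

Lemma hocolim_rel_sym R d P K : symmetric (@hocolim_rel R d P K).
Proof.
move=> u v; apply/asboolP/asboolP; exact: rst_sym.
Qed.

Lemma hocolim_rel_trans R d P K : transitive (@hocolim_rel R d P K).
Proof.
move=> v u w /asboolP H1 /asboolP H2; apply/asboolP; exact: rst_trans H1 H2.
Qed.

Definition hocolim_equiv R d P K : equiv_rel (hocolim_pre R K) :=
  @EquivRelPack _ (@hocolim_rel R d P K)
    (EquivClass (@hocolim_rel_refl R d P K)
       (@hocolim_rel_sym R d P K) (@hocolim_rel_trans R d P K)).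

Definition hocolim (R : realType) (d : Order.disp_t) (P : finPOrderType d)
  (K : top_diagram P) : topologicalType :=
  quotient_topology {eq_quot (hocolim_equiv R K)}.

Definition groth_carrier (d : Order.disp_t) (P : finPOrderType d)
  (dX : Order.disp_t) (X : poset_diagram P dX) : choiceType :=
  {p : P & pobj X p}.

Definition groth_le (d : Order.disp_t) (P : finPOrderType d)
  (dX : Order.disp_t) (X : poset_diagram P dX) : rel (groth_carrier X) :=
  fun u v =>
    (if (tag u <= tag v)%O as b return ((tag u <= tag v)%O = b -> bool)
     then fun h => (pmap X h (tagged u) <= tagged v)%O
     else fun _ => false) erefl.

Definition nh_hocolim (d : Order.disp_t) (P : finPOrderType d)
  (dX : Order.disp_t) (X : poset_diagram P dX) : topologicalType :=
  downtop (@groth_le d P dX X).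

Arguments dmor {d P dX K X} d0 p _ : rename.

(* Main.v *)
Require Import Defs.
From HB Require Import structures.
From mathcomp Require Import all_boot all_order all_algebra.
From mathcomp Require Import all_classical all_reals all_analysis.
From mathcomp Require Import generic_quotient ring lra zify.
From Stdlib Require Import Relation_Operators.

Set Implicit Arguments.
Unset Strict Implicit.
Unset Printing Implicit Defensive.

Import Order.TTheory GRing.Theory Num.Theory.
Import numFieldNormedType.Exports.
Local Open Scope classical_set_scope.
Local Open Scope ring_scope.

(* Weak homotopy equivalences are the maps with the relative lifting property
   for all the pairs (D^n, S^(n-1)). This property is local on the target: if it
   holds over the finite intersections of the members of an open cover, a lifting
   problem is solved cell by cell on a grid so fine that every cell is sent into
   a member of the cover.

   The comparison map sends the class of (alpha, beta), with alpha in K_q, to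
   phi_m (K(q -> m) alpha), where m is the least vertex of the carrier of beta.
   Over the down-set of p its source deforms onto K_p, by pushing beta to the
   vertex p, and its target onto X_p, so that it has the lifting property there
   because phi_p has it. The other down-sets follow by induction: a down-set
   without greatest element is covered by the principal down-sets of its
   elements, whose finite intersections are smaller down-sets. *)

(** * Continuity within a set *)

Lemma within_continuousP (T U : topologicalType) (A : set T) (f : T -> U) :
  {within A, continuous f} <->
  (forall x, A x -> forall O, nbhs (f x) O -> \forall y \near x, A y -> O (f y)).
Proof. exact: subspace_continuousP. Qed.

Lemma eq_within_continuous (T U : topologicalType) (A : set T) (f g : T -> U) :
  (forall x, A x -> f x = g x) ->
  {within A, continuous f} -> {within A, continuous g}.
Proof. by move=> fg; apply: subspace_eq_continuous => x /set_mem; exact: fg. Qed.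

Section WithinContinuousComp.
Context {T U W : topologicalType} (A : set T).

Lemma within_continuous_comp_in (B : set U) (f : T -> U) (g : U -> W) :
  {within B, continuous g} -> {within A, continuous f} ->
  (forall x, A x -> B (f x)) -> {within A, continuous (fun x => g (f x))}.
Proof.
move=> /within_continuousP gB /within_continuousP fA AB.
apply/within_continuousP => x Ax O xO.
have := fA x Ax _ (gB (f x) (AB _ Ax) O xO).
by apply: filterS => y fy Ay; apply: fy => //; exact: AB.
Qed.

Lemma continuous_comp_within (f : T -> U) (g : U -> W) :
  continuous g -> {within A, continuous f} ->
  {within A, continuous (fun x => g (f x))}.
Proof. by move=> gc; apply: within_continuous_comp => y _; exact: gc. Qed.

Lemma within_continuous_pair (f : T -> U) (g : T -> W) :
  {within A, continuous f} -> {within A, continuous g} ->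
  {within A, continuous (fun x => (f x, g x))}.
Proof. by move=> fc gc x; apply: cvg_pair; [exact: fc|exact: gc]. Qed.

End WithinContinuousComp.

Section WithinContinuousAlgebra.
Context {R : numFieldType} {T : topologicalType} {V : normedModType R} (A : set T).
Implicit Types (f : T -> V) (p q : T -> R).

Lemma within_continuousN f :
  {within A, continuous f} -> {within A, continuous (fun x => - f x)}.
Proof. by move=> fc x; apply: cvgN; exact: fc. Qed.

Lemma within_continuousM p q : {within A, continuous p} ->
  {within A, continuous q} -> {within A, continuous (fun x => p x * q x)}.
Proof. by move=> pc qc x; apply: cvgM; [exact: pc|exact: qc]. Qed.

Lemma within_continuousZ p f : {within A, continuous p} ->
  {within A, continuous f} -> {within A, continuous (fun x => p x *: f x)}.
Proof. by move=> pc fc x; apply: cvgZ; [exact: pc|exact: fc]. Qed.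

Lemma within_continuousV p : (forall x, A x -> p x != 0) ->
  {within A, continuous p} -> {within A, continuous (fun x => (p x)^-1)}.
Proof.
move=> p0 /subspace_continuousP pc; apply/subspace_continuousP => x Ax.
by apply: cvgV; [exact: p0|exact: pc].
Qed.

Lemma within_continuous_norm f :
  {within A, continuous f} -> {within A, continuous (fun x => `|f x|)}.
Proof. by move=> fc x; apply: cvg_norm; exact: fc. Qed.

Lemma within_continuous_sum (I : Type) (r : seq I) (P : pred I)
    (F : I -> T -> V) : (forall i, {within A, continuous (F i)}) ->
  {within A, continuous (fun x => \sum_(i <- r | P i) F i x)}.
Proof.
move=> Fc; apply: continuous_big => [|i _]; last exact: Fc.
exact: add_continuous.
Qed.

End WithinContinuousAlgebra.

Lemma within_continuous_min (R : realType) (T : topologicalType) (A : set T)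
    (p q : T -> R) :
  {within A, continuous p} -> {within A, continuous q} ->
  {within A, continuous (fun x => Num.min (p x) (q x))}.
Proof. by move=> pc qc x; apply: continuous_min; [exact: pc|exact: qc]. Qed.

Lemma within_continuous_max (R : realType) (T : topologicalType) (A : set T)
    (p q : T -> R) :
  {within A, continuous p} -> {within A, continuous q} ->
  {within A, continuous (fun x => Num.max (p x) (q x))}.
Proof. by move=> pc qc x; apply: continuous_max; [exact: pc|exact: qc]. Qed.

Lemma within_continuous_le_if (R : realFieldType) (T U : topologicalType) (A : set T)
    (p q : T -> R) (f g : T -> U) :
  {within A, continuous p} -> {within A, continuous q} ->
  {within A `&` [set x | p x <= q x], continuous f} ->
  {within A `&` [set x | q x <= p x], continuous g} ->
  (forall x, A x -> p x = q x -> f x = g x) ->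
  {within A, continuous (fun x => if p x <= q x then f x else g x)}.
Proof.
move=> pc qc /within_continuousP fc /within_continuousP gc fg.
have lt_near (p1 q1 : T -> R) x : {within A, continuous p1} ->
    {within A, continuous q1} -> A x -> p1 x < q1 x ->
    \forall y \near x, A y -> p1 y < q1 y.
  move=> p1c q1c Ax pq.
  have /within_continuousP := within_continuousD q1c (within_continuousN p1c).
  have qp0 : 0 < q1 x - p1 x by rewrite subr_gt0.
  move=> /(_ x Ax _ (lt_nbhsr qp0)); apply: filterS => y h Ay.
  by rewrite -subr_gt0; exact: h.
apply/within_continuousP => x Ax O; case: (ltgtP (p x) (q x)) => pq xO.
- have [pq_near fO] := (lt_near p q x pc qc Ax pq, fc x (conj Ax (ltW pq)) O xO).
  apply: filterS2 pq_near fO => y ypq fy Ay; rewrite (ltW (ypq Ay)).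
  by apply: fy; split=> //; exact/ltW/ypq.
- have [qp_near gO] := (lt_near q p x qc pc Ax pq, gc x (conj Ax (ltW pq)) O xO).
  apply: filterS2 qp_near gO => y yqp gy Ay; rewrite leNgt yqp //=.
  by apply: gy; split=> //; exact/ltW/yqp.
- have gO : nbhs (g x) O by rewrite -fg.
  have Ap : (A `&` [set x | p x <= q x]) x by split=> //=; rewrite pq.
  have Aq : (A `&` [set x | q x <= p x]) x by split=> //=; rewrite pq.
  apply: filterS2 (fc x Ap O xO) (gc x Aq O gO) => y fy gy Ay.
  by case: (leP (p y) (q y)) => ypq; [apply: fy|apply: gy; split=> //; exact: ltW].
Qed.

Lemma within_continuous_bigcup (T U : topologicalType) (I : choiceType)
    (D : set I) (F : I -> set T) (f : T -> U) : finite_set D ->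
  (forall i, D i -> closed (F i)) ->
  (forall i, D i -> {within F i, continuous f}) ->
  {within \bigcup_(i in D) F i, continuous f}.
Proof.
move=> finD Fcl Fc; apply/continuous_closedP => C cC; apply/closed_subspaceP.
exists (f @^-1` C `&` \bigcup_(i in D) F i); last by rewrite -setIA setIid.
rewrite setI_bigcupr; apply: closed_bigcup => // i Di.
have /continuous_closedP/(_ _ cC)/closed_subspaceP[B cB <-] := Fc i Di.
by apply: closedI => //; exact: Fcl.
Qed.

Ltac within_continuity_step := idtac;
  lazymatch goal with
  | |- {within _, continuous (fun=> ?c)} =>
      exact: (continuous_subspaceT (fun=> cvg_cst c))
  | |- {within _, continuous (fun x => x)} =>
      exact: (continuous_subspaceT (fun=> cvg_id))
  | |- {within _, continuous fst} =>
      exact: (continuous_subspaceT (fun=> cvg_fst))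
  | |- {within _, continuous snd} =>
      exact: (continuous_subspaceT (fun=> cvg_snd))
  | |- {within _, continuous (fun x => pair (@?f x) (@?g x))} =>
      refine (@within_continuous_pair _ _ _ _ f g _ _)
  | |- {within _, continuous (fun x => GRing.add (@?f x) (@?g x))} =>
      refine (@within_continuousD _ _ _ _ f g _ _)
  | |- {within _, continuous (fun x => GRing.opp (@?f x))} =>
      refine (@within_continuousN _ _ _ _ f _)
  | |- {within _, continuous (fun x => GRing.mul (@?f x) (@?g x))} =>
      refine (@within_continuousM _ _ _ f g _ _)
  | |- {within _, continuous (fun x => GRing.scale (@?f x) (@?g x))} =>
      refine (@within_continuousZ _ _ _ _ f g _ _)
  | |- {within _, continuous (fun x => GRing.inv (@?f x))} =>
      refine (@within_continuousV _ _ _ f _ _)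
  | |- {within _, continuous (fun x => Num.norm (@?f x))} =>
      refine (@within_continuous_norm _ _ _ _ f _)
  | |- {within _, continuous (fun x => Order.max (@?f x) (@?g x))} =>
      refine (@within_continuous_max _ _ _ f g _ _)
  | |- {within _, continuous (fun x => Order.min (@?f x) (@?g x))} =>
      refine (@within_continuous_min _ _ _ f g _ _)
  | |- {within _, continuous (fun x => fst (@?f x))} =>
      refine (@continuous_comp_within _ _ _ _ f fst (fun=> cvg_fst) _)
  | |- {within _, continuous (fun x => snd (@?f x))} =>
      refine (@continuous_comp_within _ _ _ _ f snd (fun=> cvg_snd) _)
  | |- {within _, continuous (fun x => @?f x)} => solve [auto]
  | |- {within ?A, continuous ?f} =>
      first [solve [auto]
            | change {within A, continuous (fun x => f x)};
              within_continuity_step]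
  end.

Ltac within_continuity := repeat within_continuity_step.

(** * Homotopy lifting problems *)

Lemma unit_int0 (R : realType) : unit_int (0 : R).
Proof. by rewrite /unit_int /= lexx ler01. Qed.

Lemma unit_int1 (R : realType) : unit_int (1 : R).
Proof. by rewrite /unit_int /= ler01 lexx. Qed.

Lemma unit_int_itv (R : realType) : @unit_int R = `[0, 1]%classic.
Proof. by apply/seteqP; split=> x /=; rewrite in_itv. Qed.

Lemma unit_int_compact (R : realType) : compact (@unit_int R).
Proof. by rewrite unit_int_itv; exact: segment_compact. Qed.

Lemma within_continuous_tube (S Z W : topologicalType) (J : set S) (D : set Z)
    (G : S * Z -> W) (z : Z) (O : set W) :
  compact J -> {within J `*` D, continuous G} -> D z ->
  (forall t, J t -> nbhs (G (t, z)) O) ->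
  \forall z' \near z, D z' -> forall t, J t -> O (G (t, z')).
Proof.
move=> /compact_near_coveringP/near_covering_withinP cJ /within_continuousP Gc Dz GO.
suff : \forall z' \near z, J `<=` [set t | D z' -> O (G (t, z'))].
  by apply: filterS => z' JO Dz' t Jt; exact: JO.
apply: cJ => t Jt; have [[B C] [/= tB zC] BC] := Gc (t, z) (conj Jt Dz) O (GO t Jt).
by exists (B, C) => // -[t' z'] [/= Bt' Cz'] Jt' Dz'; exact: (BC (t', z')).
Qed.

(* A homotopy that is constant along a track is continuous there whatever its
   time parameter does. *)
Lemma within_continuous_homotopy_track (S Y Z W : topologicalType) (J : set S)
    (A : set Y) (D : set Z) (G : S * Z -> W) (s : Y -> S) (g : Y -> Z) :
  compact J -> {within J `*` D, continuous G} -> {within A, continuous g} ->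
  (forall y, A y -> J (s y) /\ D (g y)) ->
  (forall y, A y -> s z @[z --> within A (nbhs y)] --> s y \/
     forall t, J t -> G (t, g y) = G (s y, g y)) ->
  {within A, continuous (fun y => G (s y, g y))}.
Proof.
move=> cJ Gc /within_continuousP gc sgP sP.
apply/within_continuousP => y Ay O GO; have [Is Dg] := sgP y Ay.
have [sc|Gcst] := sP y Ay.
  have [[B C] [/= sB gC] BC] :=
    (within_continuousP _ _).1 Gc (s y, g y) (conj Is Dg) O GO.
  have s_near : \forall z \near y, A z -> B (s z) := sc B sB.
  apply: filterS2 s_near (gc y Ay C gC) => z sz gz Az; have [Isz Dgz] := sgP z Az.
  by apply: (BC (s z, g z)); split; [exact: sz|exact: gz| |].
have tube : \forall z \near g y, D z -> forall t, J t -> O (G (t, z)).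
  by apply: within_continuous_tube cJ Gc Dg _ => t Jt; rewrite Gcst.
apply: filterS (gc y Ay _ tube) => z Oz Az; have [Isz Dgz] := sgP z Az.
exact: Oz.
Qed.

Section Disc.
Context {R : realType} {E : normedModType R}.
Implicit Types (x : E) (c : R).

Definition disc : set E := [set x | `|x| <= 1].
Definition sphere : set E := [set x | `|x| = 1].
Definition normalize x : E := `|x|^-1 *: x.

Lemma disc0 : disc 0.
Proof. by rewrite /disc /= normr0. Qed.

Lemma sphere_disc x : sphere x -> disc x.
Proof. by rewrite /sphere /disc /= => ->. Qed.

Lemma ger0_normrZ c x : 0 <= c -> `|c *: x| = c * `|x|.
Proof. by move=> c0; rewrite normrZ ger0_norm. Qed.

Lemma normalize_sphere x : 0 < `|x| -> sphere (normalize x).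
Proof.
by move=> x0; rewrite /sphere /normalize /= normrZ normfV normr_id mulVf ?gt_eqF.
Qed.

Lemma normalize_id x : sphere x -> normalize x = x.
Proof. by rewrite /sphere /normalize /= => ->; rewrite invr1 scale1r. Qed.

Lemma normalizeZ c x : 0 < c -> normalize (c *: x) = normalize x.
Proof.
move=> c0; rewrite /normalize ger0_normrZ ?ltW// scalerA invfM mulrAC.
by rewrite mulVf ?gt_eqF// mul1r.
Qed.

Lemma within_continuous_normalize (T : topologicalType) (A : set T) (g : T -> E) :
  (forall y, A y -> 0 < `|g y|) -> {within A, continuous g} ->
  {within A, continuous (fun y => normalize (g y))}.
Proof.
by move=> g0 gc; rewrite /normalize; within_continuity => y Ay; rewrite gt_eqF ?g0.
Qed.

End Disc.

Section HomotopyLifting.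
Context {R : realType} {T U : topologicalType} (f : T -> U) (V : set U).

Definition homotopy_over (Z : topologicalType) (D : set Z) (g0 g1 : Z -> U)
    (H : R * Z -> U) :=
  [/\ {within @unit_int R `*` D, continuous H},
      forall x, D x -> H (0, x) = g0 x,
      forall x, D x -> H (1, x) = g1 x &
      forall t x, unit_int t -> D x -> V (H (t, x))].

Definition homotopy_lift (Z : topologicalType) (D S : set Z) (a : Z -> T)
    (b : Z -> U) (h : R * Z -> U) :=
  exists (a' : Z -> T) (H : R * Z -> U),
  [/\ {within D, continuous a'}, homotopy_over D (f \o a') b H,
      forall x, S x -> a' x = a x &
      forall t x, unit_int t -> S x -> H (t, x) = h (t, x)].

(* The homotopy extension and lifting property of the pair [(D, S)]. *)
Definition homotopy_lifting (Z : topologicalType) (D S : set Z) :=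
  forall (a : Z -> T) (b : Z -> U) (h : R * Z -> U),
  {within S, continuous a} -> {within D, continuous b} ->
  (forall x, D x -> V (b x)) -> homotopy_over S (f \o a) b h ->
  homotopy_lift D S a b h.

Definition lift_problem (E : normedModType R) (a : E -> T) (b : E -> U) :=
  [/\ {within sphere, continuous a}, {within disc, continuous b},
      forall x, disc x -> V (b x) & forall x, sphere x -> f (a x) = b x].

Definition relative_lift (E : normedModType R) (a : E -> T) (b : E -> U) :=
  homotopy_lift disc sphere a b (b \o snd).

(* Maps are total functions, so that a problem with empty boundary already
   provides a point of [T]: this is what the first clause accounts for. *)
Definition lifting_property := (forall u, V u -> inhabited T) /\
  forall n (a : 'rV[R]_n -> T) (b : 'rV[R]_n -> U),
    lift_problem a b -> relative_lift a b.

End HomotopyLifting.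
Arguments homotopy_lifting R {T U} f V {Z} D S.
Arguments lifting_property R {T U} f V.

Ltac disc_lra := cbv beta delta [disc sphere unit_int mkset] in *; lra.

Section Collar.
Context {R : realType} {E : normedModType R} {W : topologicalType}.
Variables (b : E -> W) (h : R * E -> W).

Definition collar (x : E) : W :=
  if `|x| <= 2^-1 then b (2 *: x) else h (2 - 2 * `|x|, normalize x).

Lemma collar_inner x : disc x -> collar (2^-1 *: x) = b x.
Proof.
move=> dx; rewrite /collar ger0_normrZ ?invr_ge0// ifT; last disc_lra.
by rewrite scalerA divff ?scale1r.
Qed.

Hypothesis hb : forall x, sphere x -> h (1, x) = b x.

Lemma collar_outer c x : sphere x -> 2^-1 <= c -> collar (c *: x) = h (2 - 2 * c, x).
Proof.
move=> sx c2; rewrite /collar ger0_normrZ; last lra.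
rewrite (sx : `|x| = 1) mulr1; case: ifPn => [c2'|_]; last first.
  by rewrite normalizeZ ?normalize_id//; lra.
have -> : c = 2^-1 by apply/le_anti/andP.
by rewrite scalerA divff// scale1r -hb//; congr (h (_, _)); lra.
Qed.

Lemma collar_continuous : {within disc, continuous b} ->
  {within @unit_int R `*` sphere, continuous h} ->
  {within disc, continuous collar}.
Proof.
move=> bc hc; apply: within_continuous_le_if; within_continuity.
- apply: (within_continuous_comp_in bc); first by within_continuity.
  by move=> x [_ /= x2]; rewrite /disc /= ger0_normrZ//; lra.
- apply: (within_continuous_comp_in hc).
    within_continuity; apply: within_continuous_normalize; within_continuity.
    by move=> x [_ /= x2]; lra.
  move=> x [/= dx x2]; split; first by apply/andP; split => /=; disc_lra.
  by apply: normalize_sphere; lra.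
- move=> x _ x2; have -> : 2 *: x = normalize x by rewrite /normalize x2 invrK.
  by rewrite -hb ?x2; [congr (h (_, _)); lra|apply: normalize_sphere; lra].
Qed.

End Collar.

(* A time on the cylinder [I * disc] that is 0 on the bottom and 1 on the top and
   on the side; it has to be discontinuous where the bottom meets the side. *)
Section CylinderTime.
Context {R : realType} {E : normedModType R}.
Implicit Types (t : R) (x : E) (w : R * E).

Definition cylinder_time w : R := w.1 / (w.1 + (1 - w.1) * (1 - `|w.2|)).

Lemma cylinder_time_bottom x : cylinder_time (0, x) = 0.
Proof. exact: mul0r. Qed.

Lemma cylinder_time_top x : cylinder_time (1, x) = 1.
Proof. by rewrite /cylinder_time /= subrr mul0r addr0 divr1. Qed.

Lemma cylinder_time_side t x : t != 0 -> sphere x -> cylinder_time (t, x) = 1.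
Proof.
move=> t0 sx; rewrite /cylinder_time /= (sx : `|x| = 1) subrr mulr0 addr0.
exact: divff.
Qed.

Lemma cylinder_time_den_ge t x : unit_int t -> disc x ->
  0 <= t <= t + (1 - t) * (1 - `|x|).
Proof.
by move=> /andP[t0 t1] dx; rewrite t0 lerDl mulr_ge0//; disc_lra.
Qed.

Lemma cylinder_time_unit t x :
  unit_int t -> disc x -> unit_int (cylinder_time (t, x)).
Proof.
move=> It dx; have /andP[t0] := cylinder_time_den_ge It dx.
rewrite /cylinder_time /unit_int /=; set d := t + _ => td.
have d0 := le_trans t0 td; rewrite divr_ge0//=.
have [->|dn0] := eqVneq d 0; first by rewrite invr0 mulr0 ler01.
by rewrite ler_pdivrMr ?mul1r// lt_neqAle eq_sym dn0.
Qed.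

Lemma cylinder_time_cvg t x : unit_int t -> disc x ->
  cylinder_time w @[w --> within (@unit_int R `*` disc) (nbhs (t, x))]
    --> cylinder_time (t, x) \/ t = 0 /\ sphere x.
Proof.
move=> It dx; have /andP[t0] := cylinder_time_den_ge It dx.
pose den w := w.1 + (1 - w.1) * (1 - `|w.2|).
have [d0 td|dn0 _] := eqVneq (den (t, x)) 0; [right|left].
  have t00 : t = 0 by apply/le_anti; rewrite t0 andbT -d0.
  split=> //; move: d0; rewrite /den t00 /= subr0 mul1r add0r.
  by move=> /subr0_eq/esym.
have numc : {within @unit_int R `*` @disc R E, continuous (fun w => w.1 : R)}.
  by within_continuity.
have denc : {within @unit_int R `*` @disc R E, continuous den}.
  by rewrite /den; within_continuity.
apply: cvgM; first by move/subspace_continuousP: numc; exact.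
by apply: cvgV => //; move/subspace_continuousP: denc; exact.
Qed.

End CylinderTime.

Section CollarHomotopy.
Context {R : realType} {E : normedModType R} {U : topologicalType} (V : set U).
Implicit Types (g b : E -> U) (G H h K : R * E -> U).

Lemma homotopy_absorb_collar g b h G :
  (forall x, sphere x -> h (1, x) = b x) ->
  homotopy_over V disc g (collar b h) G ->
  (forall t x, unit_int t -> sphere x -> G (t, x) = h (0, x)) ->
  exists2 H, homotopy_over V disc g b H &
    forall t x, unit_int t -> sphere x -> H (t, x) = h (t, x).
Proof.
move=> h1 [Gc G0 G1 GV] Gh.
have shrink t (x : E) : unit_int t -> disc x -> disc ((1 - t / 2) *: x).
  move=> /andP[t0 t1] dx; rewrite /disc /= ger0_normrZ; last lra.
  by apply: mulr_ile1 => //; disc_lra.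
exists (fun w => G (cylinder_time w, (1 - w.1 / 2) *: w.2)).
  split.
  - apply: (within_continuous_homotopy_track (@unit_int_compact R) Gc).
        by within_continuity.
      by move=> [t x] [/= It dx]; split; [exact: cylinder_time_unit|exact: shrink].
    move=> [t x] [/= It dx]; have [tc|[-> sx]] := cylinder_time_cvg It dx.
      by left.
    right=> s Is; rewrite mul0r subr0 scale1r cylinder_time_bottom !Gh//.
    exact: unit_int0.
  - by move=> x dx; rewrite cylinder_time_bottom mul0r subr0 scale1r G0.
  - move=> x dx; rewrite cylinder_time_top G1.
      by rewrite (_ : 1 - 1 / 2 = 2^-1) ?collar_inner//; lra.
    by apply: shrink => //; exact: unit_int1.
  - by move=> t x It dx; apply: GV; [exact: cylinder_time_unit|exact: shrink].
move=> t x It sx; have [->|t0] := eqVneq t 0.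
  by rewrite cylinder_time_bottom mul0r subr0 scale1r Gh//; exact: unit_int0.
have /andP[t_ge0 t_le1] := It; rewrite cylinder_time_side//= G1; last first.
  exact/shrink/sphere_disc.
by rewrite collar_outer//; [congr (h (_, _)); lra|lra].
Qed.

(* At time [t] the homotopy lives on the disc of radius [2 - t]; its collar runs
   through [K] from time [1 - t] back to time [0]. *)
Lemma homotopy_retract_collar g b K H :
  {within @unit_int R `*` sphere, continuous K} ->
  (forall t x, unit_int t -> sphere x -> V (K (t, x))) ->
  homotopy_over V disc g b H ->
  (forall t x, unit_int t -> sphere x -> H (t, x) = K (1 - t, x)) ->
  exists2 H' : R * E -> U, homotopy_over V disc (collar g K) b H' &
    forall t x, unit_int t -> sphere x -> H' (t, x) = K (0, x).
Proof.
move=> Kc KV [Hc H0 H1 HV] HK.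
have normE t (x : E) : unit_int t -> `|(2 - t) *: x| = (2 - t) * `|x|.
  by move=> /andP[t0 t1]; rewrite ger0_normrZ//; lra.
have outerI t (x : E) : unit_int t -> disc x -> 1 <= `|(2 - t) *: x| ->
    unit_int (2 - t - `|(2 - t) *: x|) /\ 0 < `|x|.
  move=> It dx; rewrite normE// => rx; move: (It) => /andP[t0 t1].
  have r0 : 0 < 2 - t by lra.
  have rx_le : (2 - t) * `|x| <= 2 - t by rewrite ler_piMr// ltW.
  split; first by apply/andP; split; lra.
  by rewrite -(pmulr_rgt0 _ r0); exact: lt_le_trans rx.
exists (fun w => let y := (2 - w.1) *: w.2 in
  if `|y| <= 1 then H (w.1, y) else K (2 - w.1 - `|y|, normalize w.2)).
- split.
  + apply: within_continuous_le_if; within_continuity.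
    * apply: (within_continuous_comp_in Hc); first by within_continuity.
      by move=> [t x] [[/= It _] rx]; split.
    * apply: (within_continuous_comp_in Kc).
        within_continuity; apply: within_continuous_normalize; within_continuity.
        by move=> [t x] [[/= It dx] rx]; exact: (outerI t x _ _ _).2.
      move=> [t x] [[/= It dx] rx]; have [rI x0] := outerI _ _ It dx rx.
      by split=> //; exact: normalize_sphere.
    * move=> [t x] [/= It dx] y1; rewrite HK//= y1; congr (K (_, _)); first lra.
      have /andP[t0 t1] := It.
      by rewrite -[LHS]normalize_id// normalizeZ//; lra.
  + move=> x dx /=; rewrite subr0 ger0_normrZ// /collar.
    have -> : (2 * `|x| <= 1) = (`|x| <= 2^-1) by apply/idP/idP; lra.
    case: ifPn => // x2; rewrite H0//.
    by rewrite /disc /= ger0_normrZ//; lra.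
  + by move=> x dx; rewrite (_ : 2 - 1 = 1) /= ?scale1r ?(ifT _ _ dx) ?H1//; lra.
  + move=> t x It dx /=; case: ifPn => [rx|]; first exact: HV.
    rewrite -ltNge => /ltW rx; have [rI x0] := outerI _ _ It dx rx.
    by apply: KV => //; exact: normalize_sphere.
- move=> t x It sx /=; rewrite normE// (sx : `|x| = 1) mulr1 subrr normalize_id//.
  have /andP[t0 t1] := It; case: ifPn => // t1'; have -> : t = 1 by lra.
  rewrite (_ : 2 - 1 = 1); last lra.
  by rewrite scale1r HK ?subrr//; exact: unit_int1.
Qed.

End CollarHomotopy.

Section HomotopyLiftingDisc.
Context {R : realType} {E : normedModType R} {T U : topologicalType}.
Variables (f : T -> U) (V : set U).

Lemma homotopy_lift_disc (a : E -> T) (b : E -> U) (h : R * E -> U) :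
  (forall b1, lift_problem f V a b1 -> relative_lift f V a b1) ->
  {within sphere, continuous a} -> {within disc, continuous b} ->
  (forall x, disc x -> V (b x)) -> homotopy_over V sphere (f \o a) b h ->
  homotopy_lift f V disc sphere a b h.
Proof.
move=> sol ac bc bV [hc h0 h1 hV].
have collarE x : sphere x -> collar b h x = h (0, x).
  move=> sx; rewrite -[x in LHS]scale1r collar_outer//; last lra.
  by rewrite mulr1 subrr.
have [|a' [G [a'c Gh a'a Ga]]] := sol (collar b h).
  split=> //; first exact: collar_continuous.
  - move=> x dx; rewrite /collar; case: ifPn => [x2|].
      by apply: bV; rewrite /disc /= ger0_normrZ//; lra.
    rewrite -ltNge => x2; apply: hV; last by apply: normalize_sphere; lra.
    by apply/andP; split; disc_lra.
  - by move=> x sx; rewrite collarE// h0.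
have [|H Hh Hh'] := homotopy_absorb_collar h1 Gh.
  by move=> t x It sx; rewrite Ga//= collarE.
by exists a', H.
Qed.

Lemma relative_lift_deform (A : R * E -> T) (a0 a1 : E -> T) (b : E -> U) :
  continuous f -> {within @unit_int R `*` sphere, continuous A} ->
  (forall t x, unit_int t -> sphere x -> V (f (A (t, x)))) ->
  (forall x, sphere x -> A (0, x) = a0 x) ->
  (forall x, sphere x -> A (1, x) = a1 x) ->
  (forall b1, lift_problem f V a1 b1 -> relative_lift f V a1 b1) ->
  lift_problem f V a0 b -> relative_lift f V a0 b.
Proof.
move=> fc Ac AV A0 A1 sol [a0c bc bV fab].
pose K w := f (A w); have Kc : {within @unit_int R `*` sphere, continuous K}.
  exact: continuous_comp_within.
have flipI (t : R) : unit_int t -> unit_int (1 - t).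
  by move=> /andP[t0 t1]; apply/andP; split; lra.
have [||a' [H [a'c Hh a'a HK]]] :=
    homotopy_lift_disc (h := fun w => K (1 - w.1, w.2)) sol _ bc bV.
- apply: (eq_within_continuous A1); apply: (within_continuous_comp_in Ac).
    by within_continuity.
  by move=> x sx; split=> //; exact: unit_int1.
- split.
  + apply: (within_continuous_comp_in Kc); first by within_continuity.
    by move=> [t x] [/= It sx]; split=> //; exact: flipI.
  + by move=> x sx; rewrite subr0 /K A1.
  + by move=> x sx; rewrite subrr /K A0// fab.
  + by move=> t x It sx; apply: AV => //; exact: flipI.
have [H' H'h H'K] := homotopy_retract_collar Kc AV Hh HK.
exists (collar a' A), H'; split.
- by apply: collar_continuous => // x sx; rewrite A1// a'a.
- rewrite (_ : f \o collar a' A = collar (f \o a') K)//.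
  by apply/funext => x; rewrite /= /collar; case: ifP.
- move=> x sx; rewrite -[x in LHS]scale1r collar_outer//.
  + by rewrite mulr1 subrr A0.
  + by move=> y sy; rewrite A1// a'a.
  + by lra.
- by move=> t x It sx; rewrite H'K// /K A0//= fab.
Qed.

End HomotopyLiftingDisc.

Section HomotopyLiftingTransport.
Context {R : realType} {T U : topologicalType} (f : T -> U) (V : set U).

Lemma homotopy_lifting_retract (Z Z' : topologicalType) (D S : set Z)
    (D' S' : set Z') (e : Z -> Z') (r : Z' -> Z) : S `<=` D -> S' `<=` D' ->
  {within D, continuous e} -> {within D', continuous r} ->
  (forall x, D x -> D' (e x)) -> (forall x, S x -> S' (e x)) ->
  (forall x, D' x -> D (r x)) -> (forall x, S' x -> S (r x)) ->
  (forall x, D' x -> e (r x) = x) ->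
  homotopy_lifting R f V D S -> homotopy_lifting R f V D' S'.
Proof.
move=> SD SD' ec rc eD eS rD rS er hD a b h ac bc bV [hc h0 h1 hV].
have eSc : {within S, continuous e} by exact: continuous_subspaceW ec.
have [||||a1 [H [a1c [Hc H0 H1 HV] a1a Hh]]] :=
    hD (a \o e) (b \o e) (fun w => h (w.1, e w.2)).
- exact: (within_continuous_comp_in ac).
- exact: (within_continuous_comp_in bc).
- by move=> x Dx; exact/bV/eD.
- split=> [|x Sx|x Sx|t x It Sx].
  + apply: (within_continuous_comp_in hc).
      within_continuity; apply: (within_continuous_comp_in eSc).
        by within_continuity.
      by move=> [t x] [].
    by move=> [t x] [/= It Sx]; split=> //; exact: eS.
  + by rewrite h0//; exact: eS.
  + by rewrite h1//; exact: eS.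
  + by apply: hV => //; exact: eS.
exists (a1 \o r), (fun w => H (w.1, r w.2)); split=> [||x Sx|t x It Sx].
- exact: (within_continuous_comp_in a1c).
- split=> [|x Dx|x Dx|t x It Dx].
  + apply: (within_continuous_comp_in Hc).
      by within_continuity; apply: (within_continuous_comp_in rc);
        [within_continuity|move=> [t x] []].
    by move=> [t x] [/= It Dx]; split=> //; exact: rD.
  + by rewrite H0//; exact: rD.
  + by rewrite H1/= ?er//; exact: rD.
  + by apply: HV => //; exact: rD.
- by rewrite /= a1a/= ?er//; [exact: SD'|exact: rS].
- by rewrite Hh/= ?er//; [exact: SD'|exact: rS].
Qed.

End HomotopyLiftingTransport.

Section HomotopyConcat.
Context {R : realType} {Z U : topologicalType} (V : set U) (D : set Z).
Implicit Types (g : Z -> U) (H : R * Z -> U).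

Definition homotopy_concat H1 H2 (w : R * Z) : U :=
  if w.1 <= 2^-1 then H1 (2 * w.1, w.2) else H2 (2 * w.1 - 1, w.2).

Lemma homotopy_concat_forall (Q : U -> Prop) H1 H2 x :
  (forall t, unit_int t -> Q (H1 (t, x))) ->
  (forall t, unit_int t -> Q (H2 (t, x))) ->
  forall t, unit_int t -> Q (homotopy_concat H1 H2 (t, x)).
Proof.
move=> Q1 Q2 t /andP[t0 t1]; rewrite /homotopy_concat /=.
case: (leP t 2^-1) => t2; [apply: Q1|apply: Q2]; apply/andP; split; lra.
Qed.

Lemma homotopy_over_concat g0 g1 g2 H1 H2 :
  homotopy_over V D g0 g1 H1 -> homotopy_over V D g1 g2 H2 ->
  homotopy_over V D g0 g2 (homotopy_concat H1 H2).
Proof.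
move=> [H1c H10 H11 H1V] [H2c H20 H21 H2V]; split.
- apply: within_continuous_le_if; within_continuity.
  + apply: (within_continuous_comp_in H1c); first by within_continuity.
    by move=> [t x] /= [[/andP[t0 t1] Dx] t2]; split=> //; apply/andP; split=> /=; lra.
  + apply: (within_continuous_comp_in H2c); first by within_continuity.
    by move=> [t x] /= [[/andP[t0 t1] Dx] t2]; split=> //; apply/andP; split=> /=; lra.
  + by move=> [t x] [/= _ Dx] ->; rewrite divff// subrr H11// H20.
- by move=> x Dx; rewrite /homotopy_concat /= mulr0 ifT ?H10// invr_ge0.
- move=> x Dx; rewrite /homotopy_concat /= mulr1 ifF; last first.
    by apply/negbTE; rewrite -ltNge; lra.
  by rewrite (_ : 2 - 1 = 1) ?H21//; lra.
- move=> t x It Dx; apply: homotopy_concat_forall It => s Is; first exact: H1V.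
  exact: H2V.
Qed.

End HomotopyConcat.

Lemma lifting_property_inhabited (R : realType) (T U : topologicalType) (f : T -> U)
    (V : set U) :
  (forall u, V u -> lifting_property R f V) -> lifting_property R f V.
Proof.
move=> fV; split=> [u Vu|n a b pb]; first exact: (fV u Vu).1 Vu.
by have [_ _ bV _] := pb; exact: (fV _ (bV 0 disc0)).2.
Qed.

(* Lifting over [V] reduces to lifting for [f0] when the preimage of [V]
   deforms onto the source of [f0] and [V] deforms strongly onto its target. *)
Section LiftingDeformation.
Context {R : realType} {T U T0 U0 : topologicalType}.
Variables (f : T -> U) (V : set U) (f0 : T0 -> U0).
Variables (i : T0 -> T) (r : T -> T0) (rho : R * T -> T).
Variables (j : U0 -> U) (s : U -> U0) (sigma : R * U -> U).
Hypotheses (fc : continuous f) (ic : continuous i) (jc : continuous j).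
Hypotheses (rc : {within f @^-1` V, continuous r})
  (sc : {within V, continuous s}).
Hypotheses (f_i : forall x, f (i x) = j (f0 x)) (s_j : cancel j s).
Hypothesis rho_homotopy : homotopy_over (f @^-1` V) (f @^-1` V) id (i \o r) rho.
Hypothesis sigma_homotopy : homotopy_over V V (j \o s) id sigma.
Hypothesis sigma_j : forall t y, unit_int t -> sigma (t, j y) = j y.
Hypothesis V_j : forall y, V (j y).

Lemma relative_lift_included n (a0 : 'rV[R]_n -> T0) b :
  lifting_property R f0 setT -> {within sphere, continuous a0} ->
  lift_problem f V (i \o a0) b -> relative_lift f V (i \o a0) b.
Proof.
move=> lift0 a0c [_ bc bV fab]; have [sigmac sigma0 sigma1 sigmaV] := sigma_homotopy.
have bE x : sphere x -> b x = j (f0 (a0 x)) by move=> sx; rewrite -fab//= f_i.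
have [|c [G [cc [Gc G0 G1 _] ca Gb]]] := lift0.2 n a0 (s \o b).
  split=> // [|x sx]; last by rewrite /= bE// s_j.
  exact: (within_continuous_comp_in sc).
exists (i \o c), (homotopy_concat (j \o G) (fun w => sigma (w.1, b w.2))); split.
- exact: continuous_comp_within.
- apply: homotopy_over_concat.
    split=> [|x dx|x dx|t x It dx] /=; last exact: V_j.
    - exact: continuous_comp_within.
    - by rewrite G0//= f_i.
    - by rewrite G1.
  split=> [|x dx|x dx|t x It dx] /=.
  + apply: (within_continuous_comp_in sigmac).
      within_continuity; apply: (within_continuous_comp_in bc);
        [within_continuity|by move=> [t x] []].
    by move=> [t x] [/= It dx]; split=> //=; exact: bV.
  + by rewrite sigma0//; exact: bV.
  + by rewrite sigma1//; exact: bV.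
  + by apply: sigmaV => //; exact: bV.
- by move=> x sx; rewrite /= ca.
- move=> t x It sx; apply: (homotopy_concat_forall (Q := fun u => u = b x)) It => r' Ir.
    by rewrite /= Gb//= bE// s_j.
  by rewrite bE// sigma_j.
Qed.

Lemma lifting_property_deformation :
  lifting_property R f0 setT -> lifting_property R f V.
Proof.
move=> lift0; have [rhoc rho0 rho1 rhoV] := rho_homotopy.
split=> [u Vu|n a b pb]; first by case: lift0 => /(_ (s u) I)[x _]; exists; exact: i x.
have [ac _ bV fab] := pb.
have aV x : sphere x -> (f @^-1` V) (a x).
  by move=> sx; rewrite /preimage /= fab//; apply/bV/sphere_disc.
apply: (@relative_lift_deform _ _ _ _ f V (fun w => rho (w.1, a w.2)) a
  (i \o (r \o a))) => //.
- apply: (within_continuous_comp_in rhoc).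
    within_continuity; apply: (within_continuous_comp_in ac);
      [within_continuity|by move=> [t x] []].
  by move=> [t x] [/= It sx]; split=> //=; exact: aV.
- by move=> t x It sx; apply: rhoV => //; exact: aV.
- by move=> x sx; rewrite rho0//; exact: aV.
- by move=> x sx; rewrite rho1//; exact: aV.
move=> b1; apply: relative_lift_included => //.
exact: (within_continuous_comp_in rc).
Qed.

End LiftingDeformation.

(** * Cubes, discs and cylinders *)

Section Coordinates.
Context {R : realType} {T : topologicalType} (A : set T).

Lemma within_continuous_row n (F : 'I_n -> T -> R) :
  (forall i, {within A, continuous (F i)}) ->
  {within A, continuous (fun x => \row_i F i x)}.
Proof.
move=> Fc; apply: (@eq_within_continuous _ _ _
    (fun x => \sum_i F i x *: (delta_mx 0 i : 'rV[R]_n))).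
  move=> x _; rewrite [RHS]row_sum_delta; apply: eq_bigr => i _.
  by rewrite mxE.
by apply: within_continuous_sum => i; within_continuity.
Qed.

Lemma within_continuous_coord n (g : T -> 'rV[R]_n) i :
  {within A, continuous g} -> {within A, continuous (fun x => g x ord0 i)}.
Proof.
by apply: (continuous_comp_within (g := fun v : 'rV[R]_n => v ord0 i));
  exact: coord_continuous.
Qed.

Lemma within_continuous_ptws (I : Type) (K : topologicalType)
    (g : T -> {ptws I -> K}) :
  (forall i, {within A, continuous (fun x => g x i)}) -> {within A, continuous g}.
Proof.
move=> gc x; apply/cvg_sup => i O [B [[C oC <-] Cx] BO].
have gC : nbhs (x : subspace A) (fun y => C (g y i)).
  by apply: gc; exact: open_nbhs_nbhs.
by apply: filterS gC => y; exact: BO.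
Qed.

Lemma within_continuous_set_type (K : topologicalType) (B : set K)
    (g : T -> set_type B) :
  {within A, continuous (fun x => val (g x))} -> {within A, continuous g}.
Proof. by move=> gc; apply/continuous_comp_initial. Qed.

End Coordinates.

Section RowNorm.
Context {R : realType}.

Lemma row_norm_leP n (x : 'rV[R]_n) (r : R) : 0 <= r ->
  `|x| <= r <-> forall i, `|x ord0 i| <= r.
Proof.
move=> r0; rewrite /Num.norm /= mx_normrE; split.
  by move=> /bigmax_leP[_ xr] i; exact: (xr (ord0, i)).
by move=> xr; apply/bigmax_leP; split=> // -[i j] _ /=; rewrite (ord1 i); exact: xr.
Qed.

Lemma coord_le_norm n (x : 'rV[R]_n) i : `|x ord0 i| <= `|x|.
Proof. by move: i; apply/row_norm_leP. Qed.

Lemma sphere_coord_norm n (x : 'rV[R]_n) : sphere x -> exists i, `|x ord0 i| = 1.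
Proof.
move=> sx; have /mx_norm_neq0[[i j]] : `|x| != 0 by rewrite sx oner_eq0.
by rewrite (ord1 i) => xj; exists j; rewrite -sx.
Qed.

Lemma coord_sphere n (x : 'rV[R]_n) i : disc x -> `|x ord0 i| = 1 -> sphere x.
Proof.
by move=> dx xi; apply/eqP; rewrite eq_le dx -xi coord_le_norm.
Qed.

Lemma sphereP n (x : 'rV[R]_n) : disc x ->
  sphere x <-> exists i, x ord0 i = 1 \/ x ord0 i = -1.
Proof.
move=> dx; split=> [/sphere_coord_norm[i /eqP]|[i xi]].
  by rewrite eqr_norml ler01 andbT => /orP[] /eqP xi; exists i; [left|right].
by apply: (coord_sphere dx (i := i)); case: xi => ->; rewrite ?normrN normr1.
Qed.

Lemma sphere0_empty (x : 'rV[R]_0) : ~ sphere x.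
Proof. by move=> /sphere_coord_norm[[]]. Qed.

End RowNorm.

Section CubeDisc.
Context {R : realType}.

Definition clamp (r : R) : R := Num.max 0 (Num.min r 1).

Lemma clamp_unit r : unit_int (clamp r).
Proof. by rewrite /unit_int /clamp /= le_max lexx ge_max ler01 ge_min lexx orbT. Qed.

Lemma clamp_id r : unit_int r -> clamp r = r.
Proof. by move=> /andP[r0 r1]; rewrite /clamp min_l// max_r. Qed.

Definition to_unit (r : R) : set_type (@unit_int R) :=
  SigSub (mem_set (clamp_unit r)).

Lemma val_to_unit r : unit_int r -> val (to_unit r) = r.
Proof. exact: clamp_id. Qed.

Lemma unit_intP (t : set_type (@unit_int R)) : unit_int (val t).
Proof. exact: set_mem (valP t). Qed.

Lemma to_unitK t : to_unit (val t) = t.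
Proof. exact/val_inj/val_to_unit/unit_intP. Qed.

Lemma to_unit_continuous : continuous to_unit.
Proof.
apply/continuous_subspace_setT; apply: within_continuous_set_type => /=.
by rewrite /clamp; within_continuity.
Qed.

Lemma val_unit_continuous : continuous (val : set_type (@unit_int R) -> R).
Proof. exact: initial_continuous. Qed.

Definition to_cube n (x : 'rV[R]_n) : cube R n :=
  fun i => to_unit ((x ord0 i + 1) / 2).
Definition of_cube n (c : cube R n) : 'rV[R]_n := \row_i (2 * val (c i) - 1).

Lemma of_cube_disc n (c : cube R n) : disc (of_cube c).
Proof.
apply/row_norm_leP => // i; rewrite mxE ler_norml.
by have /andP[? ?] := unit_intP (c i); apply/andP; split; lra.
Qed.

Lemma of_cubeK n (c : cube R n) : to_cube (of_cube c) = c.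
Proof.
apply/funext => i; rewrite /to_cube mxE -[RHS]to_unitK; congr to_unit.
by lra.
Qed.

Lemma to_cubeK n (x : 'rV[R]_n) : disc x -> of_cube (to_cube x) = x.
Proof.
move=> dx; apply/rowP => i; rewrite mxE /to_cube val_to_unit; first lra.
have := le_trans (coord_le_norm x i) dx; rewrite ler_norml => /andP[? ?].
by apply/andP; split; lra.
Qed.

Lemma of_cube_sphere n (c : cube R n) : sphere (of_cube c) <-> cube_bdry c.
Proof.
rewrite sphereP; last exact: of_cube_disc.
by split=> -[i]; rewrite ?mxE => -[] ?; exists i; rewrite ?mxE;
  [right|left|right|left]; lra.
Qed.

Lemma to_cube_bdry n (x : 'rV[R]_n) : sphere x -> cube_bdry (to_cube x).
Proof.
by move=> sx; apply/of_cube_sphere; rewrite to_cubeK//; exact: sphere_disc.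
Qed.

Lemma to_cube_continuous n : continuous (@to_cube n).
Proof.
apply/continuous_subspace_setT; apply: within_continuous_ptws => i.
apply: (continuous_comp_within to_unit_continuous); within_continuity.
by apply: within_continuous_coord; within_continuity.
Qed.

Lemma of_cube_continuous n : continuous (@of_cube n).
Proof.
apply/continuous_subspace_setT; apply: within_continuous_row => i.
within_continuity; apply: (continuous_comp_within val_unit_continuous).
apply: continuous_subspaceT.
exact: (@proj_continuous _ (fun=> set_type (@unit_int R)) i).
Qed.

End CubeDisc.

Section DiscMap.
Context {R : realType} {T : topologicalType} (x : T).

Definition disc_map n (a : 'rV[R]_n -> T) :=
  {within disc, continuous a} /\ forall y, sphere y -> a y = x.

Definition disc_homotopic n (a0 a1 : 'rV[R]_n -> T) :=
  exists2 H, homotopy_over setT disc a0 a1 H &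
    forall (t : R) y, unit_int t -> sphere y -> H (t, y) = x.

Lemma eq_disc_homotopic n (a0 a1 b0 b1 : 'rV[R]_n -> T) :
  (forall y, disc y -> a0 y = b0 y) -> (forall y, disc y -> a1 y = b1 y) ->
  disc_homotopic a0 a1 -> disc_homotopic b0 b1.
Proof.
move=> ab0 ab1 [H [Hc H0 H1 _] Hs]; exists H => //; split=> // y dy.
  by rewrite H0// ab0.
by rewrite H1// ab1.
Qed.

Lemma disc_map_of_cube n (a : 'rV[R]_n -> T) :
  disc_map a -> based_cube_map x (a \o @of_cube R n).
Proof.
move=> [ac ax]; split=> [|c /of_cube_sphere]; last exact: ax.
apply/continuous_subspace_setT.
apply: (within_continuous_comp_in ac) => [|c _]; last exact: of_cube_disc.
exact/continuous_subspaceT/of_cube_continuous.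
Qed.

Lemma disc_map_to_cube n (g : cube R n -> T) :
  based_cube_map x g -> disc_map (g \o @to_cube R n).
Proof.
move=> [gc gx]; split=> [|y sy]; last exact/gx/to_cube_bdry.
exact/(continuous_comp_within gc)/continuous_subspaceT/to_cube_continuous.
Qed.

Lemma homotopic_rel_bdryP n (g0 g1 : cube R n -> T) :
  homotopic_rel_bdry x g0 g1 <->
  disc_homotopic (g0 \o @to_cube R n) (g1 \o @to_cube R n).
Proof.
split=> [[H [Hc H0 H1 Hx]]|[H [Hc H0 H1 _] Hx]].
  exists (fun w => H (to_unit w.1, to_cube w.2)) => [|t y It sy].
    split=> // [|y dy|y dy].
    - apply: (continuous_comp_within Hc); within_continuity.
        by apply: (continuous_comp_within to_unit_continuous); within_continuity.
      by apply: (continuous_comp_within (@to_cube_continuous R n));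
        within_continuity.
    - by rewrite H0// val_to_unit//; exact: unit_int0.
    - by rewrite H1// val_to_unit//; exact: unit_int1.
  exact/Hx/to_cube_bdry.
exists (fun w => H (val w.1, of_cube w.2)); split=> [|t c /= ->|t c /= ->|t c bc].
- apply/continuous_subspace_setT; apply: (within_continuous_comp_in Hc).
    within_continuity.
      by apply: (continuous_comp_within val_unit_continuous); within_continuity.
    by apply: (continuous_comp_within (@of_cube_continuous R n));
      within_continuity.
  by move=> [t c] _; split; [exact: unit_intP|exact: of_cube_disc].
- by rewrite H0 /= ?of_cubeK//; exact: of_cube_disc.
- by rewrite H1 /= ?of_cubeK//; exact: of_cube_disc.
- by rewrite Hx//; [exact: unit_intP|exact/of_cube_sphere].
Qed.

End DiscMap.

Lemma weak_homotopy_equivalenceP (R : realType) (T U : topologicalType) (f : T -> U) :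
  weak_homotopy_equivalence R f <->
  [/\ continuous f,
      forall u, exists t, @disc_homotopic R U u 0 (fun=> f t) (fun=> u) &
      forall n x,
        (forall b, disc_map (f x) b -> exists2 a : 'rV[R]_n -> T, disc_map x a &
           disc_homotopic (f x) (f \o a) b) /\
        (forall a0 a1 : 'rV[R]_n -> T, disc_map x a0 -> disc_map x a1 ->
           disc_homotopic (f x) (f \o a0) (f \o a1) -> disc_homotopic x a0 a1)].
Proof.
have cubeK W n (a : 'rV[R]_n -> W) y : disc y -> a (of_cube (to_cube y)) = a y.
  by move=> dy; rewrite to_cubeK.
split=> -[fc f0 fn]; split=> //.
- by move=> u; have [t /homotopic_rel_bdryP ftu] := f0 u; exists t.
- move=> n x; have [surj inj] := fn n x; split.
    move=> b bm; have [g [gx /homotopic_rel_bdryP gb]] :=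
      surj _ (disc_map_of_cube bm).
    exists (g \o @to_cube R n); first exact: disc_map_to_cube.
    by apply: eq_disc_homotopic gb => // y dy; exact: cubeK.
  move=> a0 a1 a0m a1m fa.
  have := inj _ _ (disc_map_of_cube a0m) (disc_map_of_cube a1m).
  rewrite !homotopic_rel_bdryP => a01.
  have {}a01 := a01 (eq_disc_homotopic _ _ fa).
  by apply: eq_disc_homotopic (a01 _ _) => y dy /=; rewrite ?to_cubeK.
- by move=> u; have [t ftu] := f0 u; exists t; exact/homotopic_rel_bdryP.
- move=> n x; have [surj inj] := fn n x; split.
    move=> g gx; have [a am fab] := surj _ (disc_map_to_cube gx).
    exists (a \o @of_cube R n); split; first exact: disc_map_of_cube.
    apply/homotopic_rel_bdryP.
    by apply: eq_disc_homotopic fab => // y dy /=; rewrite to_cubeK.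
  move=> h0 h1 h0x h1x /homotopic_rel_bdryP fh; apply/homotopic_rel_bdryP.
  by apply: inj => //; exact: disc_map_to_cube.
Qed.

Section Cylinder.
Context {R : realType} {n : nat}.
Implicit Types (t : R) (y : 'rV[R]_n) (x : 'rV[R]_n.+1).

Definition tail_row x : 'rV[R]_n := \row_i x ord0 (lift ord0 i).
Definition of_cylinder (w : R * 'rV[R]_n) : 'rV[R]_n.+1 :=
  \row_i oapp (w.2 ord0) (1 - 2 * w.1) (unlift ord0 i).
Definition to_cylinder x : R * 'rV[R]_n := ((1 - x ord0 ord0) / 2, tail_row x).

Lemma of_cylinder_head t y : of_cylinder (t, y) ord0 ord0 = 1 - 2 * t.
Proof. by rewrite mxE unlift_none. Qed.

Lemma of_cylinder_tail t y : tail_row (of_cylinder (t, y)) = y.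
Proof. by apply/rowP => i; rewrite !mxE liftK. Qed.

Lemma of_cylinderK : cancel of_cylinder to_cylinder.
Proof.
move=> [t y]; rewrite /to_cylinder of_cylinder_head of_cylinder_tail.
by congr (_, _); lra.
Qed.

Lemma to_cylinderK : cancel to_cylinder of_cylinder.
Proof.
move=> x; apply/rowP => i; rewrite mxE /to_cylinder /=.
by case: (unliftP ord0 i) => [j|] -> /=; [rewrite mxE|lra].
Qed.

Lemma of_cylinder_disc t y : unit_int t -> disc y -> disc (of_cylinder (t, y)).
Proof.
move=> /andP[t0 t1] dy; apply/row_norm_leP => // i; rewrite mxE.
case: (unliftP ord0 i) => [j|] _ /=; first exact: le_trans (coord_le_norm y j) dy.
by rewrite ler_norml; apply/andP; split; lra.
Qed.

Lemma to_cylinder_disc x : disc x -> (@unit_int R `*` disc) (to_cylinder x).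
Proof.
move=> dx; have coord1 i : `|x ord0 i| <= 1 := le_trans (coord_le_norm x i) dx.
split; last by apply/row_norm_leP => // i; rewrite mxE.
by have := coord1 ord0; rewrite ler_norml => /andP[? ?]; apply/andP; split=> /=; lra.
Qed.

Lemma of_cylinder_sphereP t y : unit_int t -> disc y ->
  sphere (of_cylinder (t, y)) <-> [\/ t = 0, t = 1 | sphere y].
Proof.
move=> It dy; rewrite sphereP; last exact: of_cylinder_disc.
split=> [[i]|].
  case: (unliftP ord0 i) => [j|] ->; last first.
    by rewrite of_cylinder_head => -[] ?; [apply: Or31|apply: Or32]; lra.
  by rewrite mxE liftK /= => yj; apply/Or33/sphereP => //; exists j.
case=> [->|->|/(sphereP dy)[j yj]].
- by exists ord0; rewrite of_cylinder_head; left; lra.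
- by exists ord0; rewrite of_cylinder_head; right; lra.
- by exists (lift ord0 j); rewrite mxE liftK.
Qed.

Lemma to_cylinder_sphereP x : disc x ->
  sphere x <-> [\/ (to_cylinder x).1 = 0, (to_cylinder x).1 = 1 |
                  sphere (to_cylinder x).2].
Proof.
move=> dx; have [It dy] := to_cylinder_disc dx.
by rewrite -of_cylinder_sphereP// -surjective_pairing to_cylinderK.
Qed.

Lemma of_cylinder_continuous : continuous of_cylinder.
Proof.
apply/continuous_subspace_setT; apply: within_continuous_row => i.
case: (unliftP ord0 i) => [j _|_] /=; within_continuity.
by apply: within_continuous_coord; within_continuity.
Qed.

Lemma to_cylinder_continuous : continuous to_cylinder.
Proof.
apply/continuous_subspace_setT; rewrite /to_cylinder; within_continuity.
  by apply: within_continuous_coord; within_continuity.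
apply: within_continuous_row => i.
by apply: within_continuous_coord; within_continuity.
Qed.

End Cylinder.

(** * Weak homotopy equivalences and the lifting property *)

Section LiftingWeakEquiv.
Context {R : realType} {T U : topologicalType} (f : T -> U).
Hypothesis fl : lifting_property R f setT.

Lemma lifting_property_path_surj u :
  exists t, @disc_homotopic R U u 0 (fun=> f t) (fun=> u).
Proof.
have [inh sol] := fl; have [t0] := inh u I.
have [|a [H [ac [Hc H0 H1 _] _ _]]] := sol 0 (fun=> t0) (fun=> u).
  by split=> //; [within_continuity|within_continuity|move=> x /sphere0_empty].
exists (a 0); exists H; last by move=> t y _ /sphere0_empty.
by split=> // y dy; rewrite H0//=; congr (f (a _)); apply/rowP => -[].
Qed.

Lemma lifting_property_disc_surj n x (b : 'rV[R]_n -> U) : disc_map (f x) b ->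
  exists2 a : 'rV[R]_n -> T, disc_map x a & disc_homotopic (f x) (f \o a) b.
Proof.
move=> [bc bx]; have [|a [H [ac Hh ax HB]]] := fl.2 n (fun=> x) b.
  by split=> //; [within_continuity|move=> y sy; rewrite bx].
by exists a => //; exists H => // t y It sy; rewrite HB//= bx.
Qed.

(* A homotopy between [f \o a0] and [f \o a1] is a map on the cylinder whose
   boundary lifts, by [a0] near the bottom and by [a1] near the top. *)
Lemma lifting_property_disc_inj n x (a0 a1 : 'rV[R]_n -> T) :
  disc_map x a0 -> disc_map x a1 ->
  disc_homotopic (f x) (f \o a0) (f \o a1) -> disc_homotopic x a0 a1.
Proof.
move=> [a0c a0x] [a1c a1x] [H [Hc H0 H1 _] Hx].
pose a (z : 'rV[R]_n.+1) := let w := to_cylinder z in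
  if w.1 <= 2^-1 then a0 w.2 else a1 w.2.
have cylc (A : set 'rV[R]_n.+1) : {within A, continuous to_cylinder}.
  exact/continuous_subspaceT/to_cylinder_continuous.
have [|a' [_ [a'c _ a'a _]]] := fl.2 n.+1 a (H \o to_cylinder).
  split=> // [||z sz].
  - apply: within_continuous_le_if; within_continuity.
    + by apply: (within_continuous_comp_in a0c); [within_continuity|
        move=> z [/sphere_disc/to_cylinder_disc[]]].
    + by apply: (within_continuous_comp_in a1c); [within_continuity|
        move=> z [/sphere_disc/to_cylinder_disc[]]].
    + move=> z sz z2; have /(to_cylinder_sphereP (sphere_disc sz)) := sz.
      rewrite z2 => -[/eqP|/eqP|sy]; last by rewrite a0x ?a1x.
        by rewrite invr_eq0 pnatr_eq0.
      by rewrite invr_eq1 pnatr_eq1.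
  - exact: (within_continuous_comp_in Hc (cylc _) to_cylinder_disc).
  - have [It dy] := to_cylinder_disc (sphere_disc sz).
    have /(to_cylinder_sphereP (sphere_disc sz)) := sz.
    rewrite /a /= [to_cylinder z]surjective_pairing /=; set w := to_cylinder z.
    case=> [->|->|sy]; [rewrite H0// ifT//; lra| |].
      by rewrite H1// ifF//; apply/negbTE; rewrite -ltNge; lra.
    by rewrite Hx//; case: ifP; rewrite ?a0x ?a1x.
exists (a' \o of_cylinder) => [|t y It sy].
  split=> // [|y dy|y dy].
  - apply: (within_continuous_comp_in a'c).
      exact/continuous_subspaceT/of_cylinder_continuous.
    by move=> [t y] [/= It dy]; exact: of_cylinder_disc.
  - rewrite /= a'a; last first.
      by apply/of_cylinder_sphereP => //; [exact: unit_int0|exact: Or31].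
    by rewrite /a of_cylinderK /= ifT//; lra.
  - rewrite /= a'a; last first.
      by apply/of_cylinder_sphereP => //; [exact: unit_int1|exact: Or32].
    by rewrite /a of_cylinderK /= ifF//; apply/negbTE; rewrite -ltNge; lra.
have sty : sphere (of_cylinder (t, y)).
  by apply/of_cylinder_sphereP => //; [exact: sphere_disc|exact: Or33].
by rewrite /= a'a// /a of_cylinderK /=; case: ifP; rewrite ?a0x ?a1x.
Qed.

Lemma lifting_property_weak_equiv :
  continuous f -> weak_homotopy_equivalence R f.
Proof.
move=> fc; apply/weak_homotopy_equivalenceP; split=> //.
  exact: lifting_property_path_surj.
move=> n x; split; first exact: lifting_property_disc_surj.
exact: lifting_property_disc_inj.
Qed.

End LiftingWeakEquiv.

Section WeakEquivLifting.
Context {R : realType} {T U : topologicalType} (f : T -> U).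
Hypothesis fwe : weak_homotopy_equivalence R f.

Let fc : continuous f. Proof. by case: fwe. Qed.

Lemma relative_lift_of_extension n (a : 'rV[R]_n -> T) b :
  {within disc, continuous a} ->
  lift_problem f setT a b -> relative_lift f setT a b.
Proof.
move=> ac; apply: (@relative_lift_deform _ _ _ _ f setT
  (fun w => a ((1 - w.1) *: w.2)) a (fun=> a 0)) => //.
- apply: (within_continuous_comp_in ac); first by within_continuity.
  move=> [t x] [/= /andP[t0 t1] sx]; rewrite /disc /= ger0_normrZ; last lra.
  by rewrite (sx : `|x| = 1); lra.
- by move=> x _ /=; rewrite subr0 scale1r.
- by move=> x _ /=; rewrite subrr scale0r.
move=> b1 [_ b1c _ b1s].
have /weak_homotopy_equivalenceP[_ _ /(_ n (a 0))[surj _]] := fwe.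
have [|a' [a'c a'0] [H Hh Hs]] := surj b1.
  by split=> // x sx; rewrite -b1s.
by exists a', H; split=> // t x It sx; rewrite Hs//= -b1s.
Qed.

Lemma relative_lift_cst_off_bottom n (a : 'rV[R]_n.+1 -> T) b x :
  (forall y, disc y -> a (of_cylinder (1, y)) = x) ->
  (forall t y, unit_int t -> sphere y -> a (of_cylinder (t, y)) = x) ->
  lift_problem f setT a b -> relative_lift f setT a b.
Proof.
move=> a_top a_side pb; have [ac bc _ fab] := pb.
have /weak_homotopy_equivalenceP[_ _ /(_ n x)[_ inj]] := fwe.
pose bottom y : T := a (of_cylinder (0, y)).
have cylc (A : set (R * 'rV[R]_n)) : {within A, continuous of_cylinder}.
  exact/continuous_subspaceT/of_cylinder_continuous.
have cyl_sphere t (y : 'rV[R]_n) : unit_int t -> disc y ->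
    [\/ t = 0, t = 1 | sphere y] -> sphere (of_cylinder (t, y)).
  by move=> It dy ty; exact/of_cylinder_sphereP.
have cst_map : @disc_map R T x n (fun=> x) by split=> //; within_continuity.
have bottom_map : disc_map x bottom.
  split=> [|y]; last exact/a_side/unit_int0.
  apply: (within_continuous_comp_in ac) => [|y dy].
    by apply: (within_continuous_comp_in (cylc setT)); within_continuity.
  by apply: cyl_sphere => //; [exact: unit_int0|exact: Or31].
have [|G [Gc G0 G1 _] Gx] := inj bottom (fun=> x) bottom_map cst_map.
  exists (b \o of_cylinder) => [|t y It sy].
    split=> // [|y dy|y dy].
    - apply: (within_continuous_comp_in bc) => // -[t y] [/= It dy].
      exact: of_cylinder_disc.
    - by rewrite /= fab//; apply: cyl_sphere => //; [exact: unit_int0|exact: Or31].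
    - rewrite /= -fab ?a_top//.
      by apply: cyl_sphere => //; [exact: unit_int1|exact: Or32].
  rewrite /= -fab ?a_side//.
  by apply: cyl_sphere => //; [exact: sphere_disc|exact: Or33].
have Ga z : sphere z -> G (to_cylinder z) = a z.
  move=> sz; have dz := sphere_disc sz; have [It dy] := to_cylinder_disc dz.
  rewrite -[z in RHS]to_cylinderK; have /(to_cylinder_sphereP dz) := sz.
  case: (to_cylinder z) It dy => t y /= It dy [->|->|sy]; first by rewrite G0.
    by rewrite G1// a_top.
  by rewrite Gx// a_side.
have [||c [H [cc Hh cG HB]]] := @relative_lift_of_extension _ (G \o to_cylinder) b.
- apply: (within_continuous_comp_in Gc); last exact: to_cylinder_disc.
  exact/continuous_subspaceT/to_cylinder_continuous.
- split=> // [|z sz]; last by rewrite /= Ga// fab.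
  by apply: eq_within_continuous ac => z sz; rewrite /= Ga.
by exists c, H; split=> // z sz; rewrite cG//= Ga.
Qed.

(* Pushes the sphere away from the pole [e], so that everything at distance at
   least 1 from [e] is moved to [- e]. *)
Definition push_from_pole (E : normedModType R) (e : E) (w : R * E) : E :=
  let s := w.1 * Num.min 1 `|w.2 - e| in (1 - s) *: w.2 - s *: e.

Lemma push_from_pole_neq0 (E : normedModType R) (e : E) t (x : E) :
  sphere e -> unit_int t -> sphere x -> 0 < `|push_from_pole e (t, x)|.
Proof.
move=> se /andP[t0 t1] sx; rewrite normr_gt0 /push_from_pole /=.
set m := Num.min _ _; set s := t * m.
have m0 : 0 <= m by rewrite le_min ler01 normr_ge0.
have m1 : m <= 1 by rewrite ge_min lexx.
have s0 : 0 <= s by exact: mulr_ge0.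
have s1 : s <= 1 by exact: mulr_ile1.
apply/negP; rewrite subr_eq0 => /eqP xe.
have s2 : s = 2^-1.
  have := congr1 Num.norm xe; rewrite !ger0_normrZ ?subr_ge0//.
  by rewrite (sx : `|x| = 1) (se : `|e| = 1); lra.
have {}xe : x = e.
  move: xe; rewrite s2 (_ : 1 - 2^-1 = 2^-1); last lra.
  by apply: scalerI; rewrite invr_eq0 pnatr_eq0.
by move: s2; rewrite /s /m xe subrr normr0 min_r// mulr0 => /esym/eqP;
  rewrite invr_eq0 pnatr_eq0.
Qed.

Lemma relative_lift_point (a : 'rV[R]_0 -> T) b : relative_lift f setT a b.
Proof.
have [_ f0 _] := (weak_homotopy_equivalenceP R f).1 fwe.
have y0 (y : 'rV[R]_0) : y = 0 by apply/rowP => -[].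
have [t [H [Hc H0 H1 _] _]] := f0 (b 0).
exists (fun=> t), H; split=> [||y /sphere0_empty|s y _ /sphere0_empty] //.
  by within_continuity.
by split=> // y dy; rewrite H1// (y0 y).
Qed.

Lemma relative_lift_succ n (a : 'rV[R]_n.+1 -> T) b :
  lift_problem f setT a b -> relative_lift f setT a b.
Proof.
move=> pb; have [ac bc _ fab] := pb.
pose e : 'rV[R]_n.+1 := of_cylinder (0, 0).
have se : sphere e.
  by apply/of_cylinder_sphereP; [exact: unit_int0|exact: disc0|exact: Or31].
pose M := push_from_pole e.
have Mc (A : set (R * 'rV[R]_n.+1)) : {within A, continuous M}.
  by rewrite /M /push_from_pole; within_continuity.
have M_far x : sphere x -> 1 <= `|x - e| -> normalize (M (1, x)) = - e.
  move=> sx x1; rewrite /M /push_from_pole /= min_l// mulr1 subrr scale0r scale1r.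
  by rewrite sub0r normalize_id// /sphere /= normrN.
apply: (@relative_lift_deform _ _ _ _ f setT (fun w => a (normalize (M w))) a
  (fun x => a (normalize (M (1, x))))) => //.
- apply: (within_continuous_comp_in ac) => [|[t x] [/= It sx]].
    apply: within_continuous_normalize => // -[t x] [/= It sx].
    exact: push_from_pole_neq0.
  by apply: normalize_sphere; exact: push_from_pole_neq0.
- move=> x sx; rewrite /M /push_from_pole /= !mul0r subr0 scale1r scale0r subr0.
  by rewrite normalize_id.
move=> b1; apply: (@relative_lift_cst_off_bottom _ _ _ (a (- e))) => [y dy|t y It sy].
  rewrite M_far//.
    by apply/of_cylinder_sphereP => //; [exact: unit_int1|exact: Or32].
  apply: le_trans (coord_le_norm _ ord0); rewrite !mxE unlift_none /=.
  by rewrite ler0_norm; lra.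
rewrite M_far//.
  by apply/of_cylinder_sphereP => //; [exact: sphere_disc|exact: Or33].
have [i yi] := sphere_coord_norm sy.
by apply: le_trans (coord_le_norm _ (lift ord0 i)); rewrite !mxE liftK /= mxE subr0 yi.
Qed.

Lemma weak_equiv_lifting_property : lifting_property R f setT.
Proof.
have [_ f0 _] := fwe; split=> [u _|]; first by have [t _] := f0 u.
by case=> [|n] a b pb; [exact: relative_lift_point|exact: relative_lift_succ].
Qed.

End WeakEquivLifting.

(** * The cubical subdivision of the disc *)

Lemma nat_dist_le (R : realType) (j k c : nat) :
  (`|j%:R - k%:R| <= c%:R :> R) = (j <= k + c)%N && (k <= j + c)%N.
Proof.
rewrite ler_norml lerBlDr -natrD ler_nat lerNl opprB lerBlDr -natrD ler_nat.
by rewrite andbC addnC [(c + j)%N]addnC.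
Qed.

Lemma nat_dist_lt (R : realType) (j k c : nat) :
  (`|j%:R - k%:R| < c%:R :> R) = (j < k + c)%N && (k < j + c)%N.
Proof.
rewrite ltr_norml ltrBlDr -natrD ltr_nat ltrNl opprB ltrBlDr -natrD ltr_nat.
by rewrite andbC addnC [(c + j)%N]addnC.
Qed.

Notation grid_cell n N := {ffun 'I_n -> 'I_(2 * N.+1).+1}.

Section Grid.
Context {R : realType} {n : nat} (N : nat).
Local Notation cell := (grid_cell n N).
Local Notation rV := 'rV[R]_n.
Implicit Types (e : cell) (x : rV) (S : {set cell}).

Definition grid x (i : 'I_n) : R := N.+1%:R * (x ord0 i + 1).
Definition of_grid (z : 'I_n -> R) : rV := \row_i (N.+1%:R^-1 * z i - 1).

Lemma of_gridK z i : grid (of_grid z) i = z i.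
Proof. by rewrite /grid mxE subrK mulVKf. Qed.

Lemma grid_inj x y : grid x =1 grid y -> x = y.
Proof.
move=> xy; apply/rowP => i; apply: (addIr 1); apply: (@mulfI _ N.+1%:R) => //.
exact: xy.
Qed.

(* An odd coordinate [e i] stands for the interval of radius 1 around it, an
   even one for the point [e i]. *)
Definition closed_cell e : set rV :=
  [set x | forall i, `|grid x i - (e i)%:R| <= (odd (e i))%:R].
Definition cell_bdry e : set rV :=
  [set x | closed_cell e x /\ exists2 i, odd (e i) & `|grid x i - (e i)%:R| = 1].
Definition open_cell e : set rV := closed_cell e `\` cell_bdry e.
Definition cell_dim e := #|[pred i | odd (e i)]|.
Definition cell_center e : rV := of_grid (fun i => (e i)%:R).

Lemma cell_center_in e : closed_cell e (cell_center e).
Proof. by move=> i; rewrite of_gridK subrr normr0. Qed.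

Lemma grid_even e x i : closed_cell e x -> ~~ odd (e i) -> grid x i = (e i)%:R.
Proof.
by move=> /(_ i) + /negbTE ei; rewrite ei normr_le0 subr_eq0 => /eqP.
Qed.

Lemma grid_odd_lt e x i : open_cell e x -> odd (e i) -> `|grid x i - (e i)%:R| < 1.
Proof.
move=> [ex /not_andP[//|nbd]] ei; have := ex i; rewrite ei le_eqVlt => /orP[/eqP xi|//].
by case: nbd; exists i.
Qed.

Lemma closed_cell_disc e : closed_cell e `<=` disc.
Proof.
move=> x ex; apply/row_norm_leP => // i.
suff /andP[x0 x2] : 0 <= grid x i <= (2 * N.+1)%:R.
  have N0 : 0 < N.+1%:R :> R by [].
  have := x0; rewrite pmulr_rge0// => x0'.
  move: x2; rewrite mulnC natrM ler_pM2l// => x2'.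
  by rewrite ler_norml; apply/andP; split; lra.
have := ltn_ord (e i); rewrite ltnS => e_le; have := ex i.
case: (boolP (odd (e i))) => [oi|ei _]; last first.
  by rewrite (grid_even ex ei) ler0n ler_nat.
have e_gt0 : (1 <= e i)%N by case: (e i : nat) oi.
have e_lt : ((e i).+1 <= 2 * N.+1)%N.
  by rewrite ltn_neqAle e_le andbT; apply: contraL oi => /eqP ->; rewrite oddM.
rewrite -(@ler_nat R) in e_gt0; rewrite -(@ler_nat R) -natr1 in e_lt.
by rewrite ler_norml /= => /andP[? ?]; apply/andP; split; lra.
Qed.

Lemma grid_interval (t : R) : 0 <= t <= (2 * N.+1)%:R ->
  exists j : 'I_(2 * N.+1).+1, if odd j then `|t - j%:R| < 1 : Prop else t = j%:R.
Proof.
move=> /andP[t0 tN]; have := truncn_itv t0.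
set k := Num.trunc _; rewrite -natr1 => /andP[kt tk].
have kN : (k <= 2 * N.+1)%N by rewrite -(@ler_nat R); exact: le_trans kt tN.
have [->|tk'] := eqVneq t k%:R.
  have [ok|ok] := boolP (odd k).
    by exists (inord k); rewrite inordK ?ltnS// ok subrr normr0.
  by exists (inord k); rewrite inordK ?ltnS// (negbTE ok).
have kt' : k%:R < t by rewrite lt_neqAle eq_sym tk'.
have [ok|ok] := boolP (odd k).
  exists (inord k); rewrite inordK ?ltnS// ok ltr_norml.
  by apply/andP; split; lra.
have kN' : (k < 2 * N.+1)%N by rewrite -(@ltr_nat R); exact: lt_le_trans kt' tN.
exists (inord k.+1); rewrite inordK ?ltnS//= ok -natr1 ltr_norml.
by apply/andP; split; lra.
Qed.

Lemma open_cell_exists x : disc x -> exists e, open_cell e x.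
Proof.
move=> dx; have /fin_all_exists[e ex] : forall i, exists j : 'I_(2 * N.+1).+1,
    if odd j then `|grid x i - j%:R| < 1 : Prop else grid x i = j%:R.
  move=> i; apply: grid_interval.
  have := le_trans (coord_le_norm x i) dx; rewrite ler_norml => /andP[x0 x1].
  have N0 : 0 < N.+1%:R :> R by [].
  rewrite /grid pmulr_rge0// mulnC natrM ler_pM2l//.
  by apply/andP; split; lra.
exists [ffun i => e i]; split=> [i|[_ [i]]].
  rewrite ffunE; have := ex i; case: ifP => _; first exact: ltW.
  by move=> ->; rewrite subrr normr0.
by rewrite ffunE => oi; have := ex i; rewrite oi => /lt_eqF/eqP.
Qed.

Lemma open_cell_sub e e' x :
  open_cell e x -> closed_cell e' x -> closed_cell e `<=` closed_cell e'.
Proof.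
move=> ox e'x y ey i; have [ei|ei] := boolP (odd (e i)); last first.
  by rewrite (grid_even ey ei) -(grid_even ox.1 ei).
suff -> : e' i = e i by exact: ey.
have x1 := grid_odd_lt ox ei; apply: val_inj.
have [e'i|e'i] := boolP (odd (e' i)); last first.
  have := x1; rewrite (grid_even e'x e'i) (nat_dist_lt _ _ _ 1); lia.
have : `|(e i)%:R - (e' i)%:R| < 2%:R :> R.
  have := e'x i; rewrite e'i /= => x2.
  rewrite -[X in `|X|](subrKA (grid x i)) (le_lt_trans (ler_normD _ _))//.
  by rewrite distrC; lra.
rewrite nat_dist_lt /=; lia.
Qed.

Lemma cell_dim_lt e e' : closed_cell e `<=` closed_cell e' -> e != e' ->
  (cell_dim e < cell_dim e')%N.
Proof.
move=> ee' ne.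
have cdist i : (e i <= e' i + odd (e' i))%N && (e' i <= e i + odd (e' i))%N.
  by have := ee' _ (cell_center_in e) i; rewrite of_gridK nat_dist_le.
apply: proper_card; apply/properP; split.
  by apply/fintype.subsetP => i; rewrite !inE; have := cdist i; lia.
have [i nei] : exists i, e i != e' i.
  apply/existsP; apply: contraNT ne; rewrite negb_exists => /forallP h.
  by apply/eqP/ffunP => i; apply/eqP; rewrite -[_ == _]negbK; exact: h.
by exists i; rewrite !inE; have := cdist i; move: nei; rewrite -val_eqE /=; lia.
Qed.

Lemma cell_bdryE e : cell_bdry e =
  \bigcup_(e' in [set e' | closed_cell e' `<=` closed_cell e /\ e' != e])
    closed_cell e'.
Proof.
apply/seteqP; split=> x.
  move=> bx; have [ex _] := bx.
  have [e' oe'] := open_cell_exists (closed_cell_disc ex).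
  exists e'; last by case: oe'.
  split; first exact: open_cell_sub oe' ex.
  by apply/eqP => e'e; case: oe' => _; rewrite e'e.
move=> [e' [e'e ne] e'x]; apply: contrapT => nbx.
have /open_cell_sub/(_ e'x) ee' : open_cell e x by split=> //; exact: e'e.
have := cell_dim_lt e'e ne; have := cell_dim_lt ee'.
by rewrite eq_sym => /(_ ne); lia.
Qed.

Lemma cell_center_dist e x : closed_cell e x -> `|cell_center e - x| <= N.+1%:R^-1.
Proof.
move=> ex; apply/row_norm_leP; first by rewrite invr_ge0.
move=> i; rewrite !mxE.
rewrite (_ : _ - _ = N.+1%:R^-1 * ((e i)%:R - grid x i)); last first.
  by rewrite mulrBr mulKf//; ring.
rewrite normrM ger0_norm ?invr_ge0// ler_piMr ?invr_ge0//.
by rewrite distrC; apply: le_trans (ex i) _; case: (odd _).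
Qed.

Lemma open_cell_sphere e x : open_cell e x -> sphere x -> closed_cell e `<=` sphere.
Proof.
move=> ox sx y ey; have dx := sphere_disc sx.
have /(sphereP dx)[i xi] := sx.
have [k gx ek] : exists2 k, grid x i = k%:R & ~~ odd k.
  case: xi => xi; rewrite /grid xi; last by exists 0%N; rewrite ?addNr ?mulr0.
  by exists (2 * N.+1)%N; rewrite ?oddM// mulnC natrM.
have ei : ~~ odd (e i).
  apply/negP => oi; have := grid_odd_lt ox oi; rewrite gx (nat_dist_lt _ _ _ 1).
  by move=> /andP[ke ek']; move: ek; rewrite (_ : k = e i :> nat) ?oi//; lia.
have : grid y i = grid x i by rewrite (grid_even ey ei) (grid_even ox.1 ei).
have N0 : N.+1%:R != 0 :> R by [].
move=> /(mulfI N0) yx.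
apply/(sphereP (closed_cell_disc ey)); exists i.
by case: xi => xi; [left|right]; lra.
Qed.

Lemma closed_cell_closed e : closed (closed_cell e).
Proof.
rewrite (_ : closed_cell e = \bigcap_(i in [set: 'I_n])
    [set x | `|grid x i - (e i)%:R| <= (odd (e i))%:R]); last first.
  by apply/seteqP; split=> [x ex i _|x ex i]; [exact: ex|exact: (ex i I)].
apply: closed_bigI => i _.
apply: (@closed_comp _ _ (fun x => `|grid x i - (e i)%:R|)
          [set r : R | r <= (odd (e i))%:R]) => [x _|]; last exact: closed_le.
move: x; apply/continuous_subspace_setT; rewrite /grid; within_continuity.
by apply: within_continuous_coord; within_continuity.
Qed.

Lemma bigcup_closed_cell : \bigcup_(e in [set: cell]) closed_cell e = disc.
Proof.
apply/seteqP; split=> [x [e _]|x dx]; first exact: closed_cell_disc.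
by have [e [ex _]] := open_cell_exists dx; exists e.
Qed.

End Grid.
Arguments closed_cell R {n N} e.
Arguments cell_bdry R {n N} e.
Arguments open_cell R {n N} e.

Section CellHomotopyLifting.
Context {R : realType} {T U : topologicalType} (f : T -> U) (V : set U).
Context {n N : nat} (e : grid_cell n N).
Hypothesis fV : lifting_property R f V.

Let odd_coord := [pred i | odd (e i)].
Let m := #|odd_coord|.

Definition cell_emb (y : 'rV[R]_m) : 'rV[R]_n :=
  of_grid N (fun i => (e i)%:R + \sum_(j < m | enum_val j == i) y ord0 j).
Definition cell_proj (x : 'rV[R]_n) : 'rV[R]_m :=
  \row_j (grid N x (enum_val j) - (e (enum_val j))%:R).

Let odd_enum_val (j : 'I_m) : odd (e (enum_val j)).
Proof. by have := enum_valP j; rewrite inE. Qed.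

Let odd_enum_rank i : odd (e i) -> exists j : 'I_m, i = enum_val j.
Proof.
by move=> oi; have iA : i \in odd_coord by []; exists (enum_rank_in iA i);
  rewrite enum_rankK_in.
Qed.

Lemma grid_cell_emb_odd y j :
  grid N (cell_emb y) (enum_val j) - (e (enum_val j))%:R = y ord0 j.
Proof.
rewrite of_gridK addrC addKr (big_pred1 j)// => k.
by rewrite (inj_eq enum_val_inj).
Qed.

Lemma grid_cell_emb_even y i : ~~ odd (e i) -> grid N (cell_emb y) i = (e i)%:R.
Proof.
move=> oi; rewrite of_gridK big_pred0 ?addr0// => j; apply/negbTE.
by apply: contraNneq oi => <-; exact: odd_enum_val.
Qed.

Lemma cell_emb_closed y : disc y -> closed_cell R e (cell_emb y).
Proof.
move=> dy i; have [oi|oi] := boolP (odd (e i)); last first.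
  by rewrite grid_cell_emb_even// subrr normr0.
have [j ->] := odd_enum_rank oi; rewrite grid_cell_emb_odd.
exact: le_trans (coord_le_norm _ _) dy.
Qed.

Lemma cell_emb_bdry y : sphere y -> cell_bdry R e (cell_emb y).
Proof.
move=> sy; split; first exact/cell_emb_closed/sphere_disc.
have [j yj] := sphere_coord_norm sy.
by exists (enum_val j); rewrite ?grid_cell_emb_odd.
Qed.

Lemma cell_proj_disc x : closed_cell R e x -> disc (cell_proj x).
Proof.
by move=> ex; apply/row_norm_leP => // j; rewrite mxE (le_trans (ex _))// odd_enum_val.
Qed.

Lemma cell_proj_sphere x : cell_bdry R e x -> sphere (cell_proj x).
Proof.
move=> [ex [i oi xi]]; have [j ij] := odd_enum_rank oi.
by apply: (coord_sphere (cell_proj_disc ex) (i := j)); rewrite mxE -ij.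
Qed.

Lemma cell_projK x : closed_cell R e x -> cell_emb (cell_proj x) = x.
Proof.
move=> ex; apply: (grid_inj (N := N)) => i.
have [oi|oi] := boolP (odd (e i)); last first.
  by rewrite grid_cell_emb_even// (grid_even ex oi).
have [j ->] := odd_enum_rank oi; apply: (addIr (- (e (enum_val j))%:R)).
by rewrite grid_cell_emb_odd mxE.
Qed.

Lemma cell_emb_continuous : continuous cell_emb.
Proof.
apply/continuous_subspace_setT; apply: within_continuous_row => i.
within_continuity; apply: within_continuous_sum => j.
by apply: within_continuous_coord; within_continuity.
Qed.

Lemma cell_proj_continuous : continuous cell_proj.
Proof.
apply/continuous_subspace_setT; apply: within_continuous_row => j.
rewrite /grid; within_continuity.
by apply: within_continuous_coord; within_continuity.
Qed.

Lemma homotopy_lifting_cell :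
  homotopy_lifting R f V (closed_cell R e) (cell_bdry R e).
Proof.
apply: (@homotopy_lifting_retract R _ _ f V _ _
  (@disc R 'rV[R]_m) (@sphere R 'rV[R]_m) _ _ cell_emb cell_proj).
- exact: sphere_disc.
- by move=> x [].
- exact/continuous_subspaceT/cell_emb_continuous.
- exact/continuous_subspaceT/cell_proj_continuous.
- exact: cell_emb_closed.
- exact: cell_emb_bdry.
- exact: cell_proj_disc.
- exact: cell_proj_sphere.
- exact: cell_projK.
- move=> a b h; apply: homotopy_lift_disc => b1; exact: fV.2.
Qed.

End CellHomotopyLifting.

Lemma closed_setX (T U : topologicalType) (A : set T) (B : set U) :
  closed A -> closed B -> closed (A `*` B).
Proof.
move=> cA cB; rewrite (_ : A `*` B = fst @^-1` A `&` snd @^-1` B)//.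
by apply: closedI; apply: closed_comp => // x _; [exact: cvg_fst|exact: cvg_snd].
Qed.

Lemma unit_int_closed (R : realType) : closed (@unit_int R).
Proof. by rewrite unit_int_itv; exact: itv_closed. Qed.

(* The homotopy of a lift over the cell [e] has to stay in [V e]. As [V] grows
   with the cell, what is built on the faces of [e] complies. *)
Section CellwiseLift.
Context {R : realType} {T U : topologicalType} (f : T -> U) {n N : nat}.
Local Notation cell := (grid_cell n N).
Context (b : 'rV[R]_n -> U) (V : cell -> set U).
Implicit Types (e : cell) (S : {set cell}) (a : 'rV[R]_n -> T)
  (H : R * 'rV[R]_n -> U).

Hypothesis V_lift : forall e, lifting_property R f (V e).
Hypothesis V_mono : forall e e',
  closed_cell R e `<=` closed_cell R e' -> V e `<=` V e'.
Hypothesis bc : {within disc, continuous b}.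
Hypothesis bV : forall e x, closed_cell R e x -> V e (b x).

Definition face_closed S := forall e e',
  closed_cell R e `<=` closed_cell R e' -> e' \in S -> e \in S.

Definition cell_lift e a H := {within closed_cell R e, continuous a} /\
  homotopy_over (V e) (closed_cell R e) (f \o a) b H.

Definition cellwise_lift S a H := forall e, e \in S -> cell_lift e a H.

Definition eq_on_cell e a a' H H' := forall x, closed_cell R e x ->
  a' x = a x /\ forall t : R, unit_int t -> H' (t, x) = H (t, x).

Lemma eq_cell_lift e a a' H H' :
  eq_on_cell e a a' H H' -> cell_lift e a H -> cell_lift e a' H'.
Proof.
move=> eqe [ac [Hc H0 H1 HV]]; split.
  by apply: eq_within_continuous ac => x /eqe[].
split=> [|x ex|x ex|t x It ex].
- by apply: eq_within_continuous Hc => -[t x] [/= It /eqe[_ ->]].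
- by have [/= -> ->] := eqe x ex; [rewrite H0|exact: unit_int0].
- by have [_ ->] := eqe x ex; [rewrite H1|exact: unit_int1].
- by have [_ ->] := eqe x ex; first exact: HV.
Qed.

Lemma cellwise_lift_bdry e S a H :
  (forall e', closed_cell R e' `<=` closed_cell R e -> e' != e -> e' \in S) ->
  cellwise_lift S a H ->
  {within cell_bdry R e, continuous a} /\
  homotopy_over (V e) (cell_bdry R e) (f \o a) b H.
Proof.
move=> eS lift; pose F := [set e' | closed_cell R e' `<=` closed_cell R e /\ e' != e].
have FS e' : F e' -> e' \in S by case; exact: eS.
have finF : finite_set F by exact: finite_finset.
split.
  rewrite cell_bdryE; apply: within_continuous_bigcup => // e' Fe'.
    exact: closed_cell_closed.
  exact: (lift e' (FS _ Fe')).1.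
split=> [|x|x|t x It].
- rewrite cell_bdryE setX_bigcupr; apply: within_continuous_bigcup => // e' Fe'.
    by apply: closed_setX; [exact: unit_int_closed|exact: closed_cell_closed].
  by case: (lift e' (FS _ Fe')).2.
- by rewrite cell_bdryE => -[e' /FS/lift[_ [_ H0 _ _]]]; exact: H0.
- by rewrite cell_bdryE => -[e' /FS/lift[_ [_ _ H1 _]]]; exact: H1.
- rewrite cell_bdryE => -[e' /[dup] Fe' /FS/lift[_ [_ _ _ HV]] e'x].
  by apply: (V_mono Fe'.1); exact: HV.
Qed.

Lemma cellwise_lift_attach e S a H : face_closed S -> e \notin S ->
  (forall e', closed_cell R e' `<=` closed_cell R e -> e' != e -> e' \in S) ->
  cellwise_lift S a H ->
  exists a' H', cellwise_lift (e |: S) a' H' /\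
    (forall e', e' \in S -> eq_on_cell e' a a' H H').
Proof.
move=> fcS eS facesS lift; have [ac hH] := cellwise_lift_bdry facesS lift.
have [||a1 [H1 [a1c [H1c H10 H11 H1V] a1a H1H]]] :=
    homotopy_lifting_cell (V_lift e) ac _ _ hH.
- exact: continuous_subspaceW (@closed_cell_disc R n N e) bc.
- exact: bV.
pose a' := patch a (open_cell R e) a1.
pose H' := patch H (setT `*` open_cell R e) H1.
have eq_e : eq_on_cell e a1 a' H1 H'.
  move=> x ex; have [ox|nox] := pselect (open_cell R e x).
    by split=> [|t It]; rewrite /a' /H' /patch mem_set.
  have bx : cell_bdry R e x by apply: contrapT => nbx; apply: nox.
  rewrite /a' /H' /patch memNset// a1a//; split=> // t It.
  by rewrite memNset ?H1H// => -[].
have eqS e' : e' \in S -> eq_on_cell e' a a' H H'.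
  move=> e'S x e'x.
  have nox : ~ open_cell R e x.
    move=> ox; move/negP: eS; apply.
    exact: fcS (open_cell_sub ox e'x) e'S.
  rewrite /a' /H' /patch memNset//; split=> // t It.
  by rewrite memNset// => -[].
exists a', H'; split=> // e'; rewrite !inE => /orP[/eqP ->{e'}|e'S].
  exact: eq_cell_lift eq_e _.
exact: eq_cell_lift (eqS e' e'S) (lift e' e'S).
Qed.

Lemma cellwise_lift_extend S a H : face_closed S -> cellwise_lift S a H ->
  exists a' H', cellwise_lift [set: cell]%SET a' H' /\
    (forall e', e' \in S -> eq_on_cell e' a a' H H').
Proof.
have [k] := ubnP #|~: S|; elim: k S a H => // k IH S a H le_k fcS lift.
have [S0|[e0 e0S]] := set_0Vmem (~: S)%SET.
  exists a, H; split=> // e _; apply: lift.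
  by rewrite -[S]finset.setCK S0 finset.setC0 finset.in_setT.
case: (arg_minnP (@cell_dim n N) e0S) => e /finset.setCP/negP eS mine.
have facesS e' : closed_cell R e' `<=` closed_cell R e -> e' != e -> e' \in S.
  move=> e'e ne; apply: contraT => e'S.
  have /mine : e' \in (~: S)%SET by rewrite inE.
  by rewrite leqNgt (cell_dim_lt e'e ne).
have [a1 [H1 [lift1 eq1]]] := cellwise_lift_attach fcS eS facesS lift.
have [|||a2 [H2 [lift2 eq2]]] := IH (e |: S) a1 H1 => //.
- apply: leq_trans (proper_card _) le_k; apply/properP; split.
    by rewrite finset.setCS finset.subsetUr.
  by exists e; rewrite !inE ?eS// eqxx.
- move=> e1 e2 e12; rewrite !inE => /orP[/eqP e2e|e2S].
    by have [//|ne] := eqVneq e1 e; rewrite facesS// -e2e.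
  by rewrite (fcS _ _ e12)// orbT.
exists a2, H2; split=> // e' e'S x e'x.
have [-> H12] := eq2 e' (finset.setU1r e e'S) x e'x.
have [-> H1H] := eq1 e' e'S x e'x; split=> // t It.
by rewrite H12 ?H1H.
Qed.

Lemma cellwise_relative_lift (W : set U) a : (forall e, V e `<=` W) ->
  lift_problem f W a b -> relative_lift f W a b.
Proof.
move=> VW [ac _ _ fab].
pose S : {set cell} := [set e : cell | `[< closed_cell R e `<=` sphere >]]%SET.
have SP e : e \in S <-> closed_cell R e `<=` sphere.
  by rewrite inE; split=> [/asboolP|?]; [|exact/asboolP].
have fcS : face_closed S.
  by move=> e e' ee' /SP e'S; apply/SP; exact: subset_trans e'S.
have liftS : cellwise_lift S a (b \o snd).
  move=> e /SP eS; split; first exact: continuous_subspaceW ac.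
  split=> // [|x ex|t x It ex]; last exact: bV.
    apply: (within_continuous_comp_in bc); first by within_continuity.
    by move=> [t x] [_ /closed_cell_disc].
  by rewrite /= fab//; exact: eS.
have [a' [H [lift eqS]]] := cellwise_lift_extend fcS liftS.
have {}lift e := lift e (finset.in_setT e).
have cover x : disc x -> exists e : cell, closed_cell R e x.
  by rewrite -(bigcup_closed_cell N) => -[e _ ex]; exists e.
have S_cover x : sphere x -> exists2 e, e \in S & closed_cell R e x.
  move=> sx; have [e oe] := open_cell_exists N (sphere_disc sx).
  by exists e; [apply/SP; exact: open_cell_sphere oe sx|case: oe].
exists a', H; split=> [||x /S_cover[e eS ex]|t x It /S_cover[e eS ex]].
- rewrite -(bigcup_closed_cell N).
  apply: within_continuous_bigcup => [|e _|e _]; first exact: finite_finset.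
    exact: closed_cell_closed.
  exact: (lift e).1.
- split=> [|x /cover[e ex]|x /cover[e ex]|t x It /cover[e ex]].
  + rewrite -(bigcup_closed_cell N) setX_bigcupr.
    apply: within_continuous_bigcup => [|e _|e _]; first exact: finite_finset.
      by apply: closed_setX; [exact: unit_int_closed|exact: closed_cell_closed].
    by case: (lift e).2.
  + by case: (lift e).2 => _ + _ _; exact.
  + by case: (lift e).2 => _ _ + _; exact.
  + by apply: (VW e); case: (lift e).2 => _ _ _; exact.
- by case: (eqS e eS x ex).
- by case: (eqS e eS x ex) => _; exact.
Qed.

End CellwiseLift.

(** * Open covers *)

Lemma lebesgue_number (R : realType) (M : pseudoMetricType R)
    (U : topologicalType) (I : Type) (D : set I) (V : I -> set U) (A : set M)
    (g : M -> U) : compact A -> {within A, continuous g} ->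
  (forall i, D i -> open (V i)) -> (forall x, A x -> exists2 i, D i & V i (g x)) ->
  exists2 d : R, 0 < d & forall x, A x ->
    exists2 i, D i & forall y, A y -> ball x d y -> V i (g y).
Proof.
move=> /compact_near_coveringP/near_covering_withinP cA /within_continuousP gc oV AV.
pose fits d x := exists2 i, D i & forall y, A y -> ball x d y -> V i (g y).
have fits_near : \forall d \near 0^'+, A `<=` fits d.
  apply: cA => x Ax; have [i Di Vx] := AV x Ax.
  have /nbhs_ballP[e /= e0 eV] := gc x Ax _ (open_nbhs_nbhs (conj (oV i Di) Vx)).
  have e20 : 0 < e / 2 by rewrite divr_gt0.
  exists (ball x (e / 2), [set d | d < e / 2]).
    by split; [exact: nbhsx_ballx|exact: nbhs_right_lt].
  move=> [x' d] [/= xx' de] Ax'; exists i => // y Ay x'y; apply: eV => //.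
  by apply: ball_split xx' _; apply: le_ball x'y; exact: ltW.
have [d [d0 Ad]] : exists d : R, 0 < d /\ A `<=` fits d.
  apply: (@filter_ex _ (0 : R)^'+).
  by apply: filterI => //; exact: nbhs_right_gt.
by exists d.
Qed.

Lemma disc_compact (R : realType) n : compact (@disc R 'rV[R]_n).
Proof.
apply: bounded_closed_compact.
  by exists 1; split=> // M M1 x /= dx; apply: le_trans dx (ltW M1).
apply: (@closed_comp _ _ (fun x : 'rV[R]_n => `|x|) [set r : R | r <= 1]) => [x _|].
  exact: norm_continuous.
exact: closed_le.
Qed.

Lemma grid_subordinate_cover (R : realType) (U : topologicalType) n (I : Type)
    (D : set I) (V : I -> set U) (b : 'rV[R]_n -> U) : {within disc, continuous b} ->
  (forall i, D i -> open (V i)) ->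
  (forall x, disc x -> exists2 i, D i & V i (b x)) ->
  exists N, forall e : grid_cell n N,
    exists i, D i /\ forall x, closed_cell R e x -> V i (b x).
Proof.
move=> bc oV bV.
have [d d0 dP] := lebesgue_number (@disc_compact R n) bc oV bV.
exists (Num.trunc d^-1) => e.
have ce := @cell_center_in R _ _ e.
have [i Di Vi] := dP _ (closed_cell_disc ce).
exists i; split=> // x ex; apply: Vi; first exact: closed_cell_disc ex.
rewrite -ball_normE /ball_ /=; apply: le_lt_trans (cell_center_dist ex) _.
by rewrite invf_plt ?posrE// truncnS_gt.
Qed.

Theorem lifting_property_cover (R : realType) (T U : topologicalType) (f : T -> U)
    (I : choiceType) (D : set I) (V : I -> set U) :
  (forall i, D i -> open (V i)) ->
  (forall J : set I, finite_set J -> J !=set0 -> J `<=` D ->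
     lifting_property R f (\bigcap_(i in J) V i)) ->
  lifting_property R f (\bigcup_(i in D) V i).
Proof.
move=> oV VJ; split=> [u [i Di Vu]|n a b [ac bc bV fab]].
  have [|||inh _] := VJ [set i]; [exact: finite_set1|by exists i|by move=> _ ->|].
  by apply: (inh u) => _ ->.
have [N /choice[i iP]] := grid_subordinate_cover bc oV bV.
pose J (e : grid_cell n N) := i @` [set e' | closed_cell R e `<=` closed_cell R e'].
apply: (@cellwise_relative_lift _ _ _ _ _ N _ (fun e => \bigcap_(j in J e) V j)).
- move=> e; apply: VJ; [|by exists (i e); exists e|].
    exact/finite_image/finite_finset.
  by move=> _ [e' _ <-]; case: (iP e').
- move=> e e' ee' u Ju _ [e'' e'e'' <-]; apply: Ju; exists e'' => //.
  exact: subset_trans e'e''.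
- exact: bc.
- by move=> e x ex _ [e' ee' <-]; exact/(iP e').2/ee'.
- by move=> e u Ju; exists (i e); [case: (iP e)|apply: Ju; exists e].
- by split.
Qed.

(** * Finite spaces *)

Section Downtop.
Context {T : choiceType} (le : rel T).

Lemma downtop_open (A : set (downtop le)) : down_open A -> open A.
Proof. by []. Qed.

Lemma within_continuous_downtop (Z : topologicalType) (A : set Z)
    (g : Z -> downtop le) :
  (forall z, A z -> \forall y \near z, A y -> le (g y) (g z)) ->
  {within A, continuous g}.
Proof.
move=> gle; apply/within_continuousP => z Az O.
rewrite nbhsE => -[B [oB Bz] BO]; apply: filterS (gle z Az) => y yz Ay; apply: BO.
by apply: (oB _ _ _ Bz); exact: yz.
Qed.

Hypotheses (le_refl : reflexive le) (le_trans : transitive le).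

Lemma near_downtop_le (Z : topologicalType) (A : set Z) (g : Z -> downtop le) z :
  {within A, continuous g} -> A z -> \forall y \near z, A y -> le (g y) (g z).
Proof.
move=> /within_continuousP gc Az; apply: (gc z Az [set w : downtop le | le w (g z)]).
apply: open_nbhs_nbhs; split; last exact: le_refl.
by move=> x y yx xz; exact: le_trans yx xz.
Qed.

End Downtop.

Lemma homo_downtop_within (T T' : choiceType) (le : rel T) (le' : rel T')
    (A : set (downtop le)) (g : downtop le -> downtop le') : reflexive le ->
  transitive le -> (forall u v : T, A u -> A v -> le u v -> le' (g u) (g v)) ->
  {within A, continuous g}.
Proof.
move=> le_refl le_trans gle; apply: within_continuous_downtop => v Av.
have idc : {within A, continuous (fun u : downtop le => u)} by within_continuity.
apply: filterS (near_downtop_le le_refl le_trans idc Av) => u uv Au.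
by apply: gle => //; exact: uv.
Qed.

Lemma downtop_le_homotopy (R : realType) (T : choiceType) (le : rel T)
    (Z : topologicalType) (V : set (downtop le)) (D : set Z)
    (g0 g1 : Z -> downtop le) : reflexive le -> transitive le ->
  {within D, continuous g0} -> {within D, continuous g1} ->
  (forall z, D z -> [/\ V (g0 z), V (g1 z) & le (g1 z) (g0 z)]) ->
  homotopy_over V D g0 g1 (fun w : R * Z => if w.1 <= 0 then g0 w.2 else g1 w.2).
Proof.
move=> le_refl le_trans g0c g1c gD.
split=> [|z _|z _|t z _ /gD[]] /=; rewrite ?lexx ?ler10//; last by case: ifP.
have sndc (g : Z -> downtop le) : {within D, continuous g} ->
    {within @unit_int R `*` D, continuous (fun w => g w.2)}.
  by move=> gc; apply: (within_continuous_comp_in gc);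
    [within_continuity|move=> [t z] []].
have near_le g w gc := @near_downtop_le _ le le_refl le_trans _ _ _ w (sndc g gc).
apply: within_continuous_downtop => -[t z] tDz; case: (leP t 0) => t0 /=.
  apply: filterS (near_le g0 (t, z) g0c tDz) => -[s y] g0yz sDy.
  case: ifP => _; first exact: g0yz.
  by have [_ _ g10] := gD y sDy.2; apply: le_trans g10 (g0yz sDy).
have s_gt0 : \forall w \near (t, z), 0 < w.1.
  have := @cvg_fst R Z (nbhs t) (nbhs z) _ [set s | 0 < s]; apply.
  exact: lt_nbhsr.
apply: filterS2 s_gt0 (near_le g1 (t, z) g1c tDz) => -[s y] /= s0 g1yz sDy.
by rewrite leNgt s0; exact: g1yz.
Qed.

Lemma downset_bigcup_principal (d : Order.disp_t) (P : finPOrderType d) (D : {set P}) :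
  (forall r s, (s <= r)%O -> r \in D -> s \in D) ->
  [set` D] = \bigcup_(p in [set` D]) [set r | (r <= p)%O].
Proof.
move=> dD; apply/seteqP; split=> [r rD|r [p /= pD rp]]; last exact: dD rp pD.
by exists r => /=.
Qed.

Theorem lifting_property_principal_downsets (R : realType)
    (T U : topologicalType) (f : T -> U) (d : Order.disp_t)
    (P : finPOrderType d) (tau : U -> finspace P) :
  continuous tau ->
  (forall p, lifting_property R f (tau @^-1` [set r : P | (r <= p)%O])) ->
  lifting_property R f setT.
Proof.
move=> tauc below_lift.
have below_open p : open (tau @^-1` [set r : P | (r <= p)%O]).
  apply: open_comp => [u _|]; first exact: tauc.
  by apply: downtop_open => r s sr rp; exact: le_trans rp.
suff over (D : {set P}) : (forall r s, (s <= r)%O -> r \in D -> s \in D) ->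
    lifting_property R f (tau @^-1` [set` D]).
  rewrite (_ : setT = tau @^-1` [set` [set: P]%SET]).
    by apply: over => r s _ _; rewrite inE.
  by apply/seteqP; split=> u //= _; rewrite inE.
have [k] := ubnP #|D|; elim: k D => // k IH D le_k dD.
have [[p pD Dp]|nprincipal] :=
    pselect (exists2 p, p \in D & forall r, r \in D -> (r <= p)%O).
  rewrite (_ : [set` D] = [set r | (r <= p)%O]) //.
  by apply/seteqP; split=> r /=; [exact: Dp|move=> rp; exact: dD rp pD].
rewrite (downset_bigcup_principal dD) preimage_bigcup.
apply: lifting_property_cover => //.
move=> J _ [p Jp] JD.
pose E : {set P} := [set r : P in D | `[< forall q, J q -> (r <= q)%O >]]%SET.
have EP r : r \in E <-> forall q, J q -> (r <= q)%O.
  rewrite !inE; split=> [/andP[_ /asboolP]//|rJ].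
  by apply/andP; split; [exact: dD (rJ p Jp) (JD p Jp)|exact/asboolP].
rewrite (_ : \bigcap_(q in J) _ = tau @^-1` [set` E]); last first.
  by apply/seteqP; split=> u /= uJ; [apply/EP => q|move/EP: uJ => uJ q]; exact: uJ.
apply: IH => [|r s sr /EP rJ]; last by apply/EP => q Jq; exact: le_trans (rJ q Jq).
apply: leq_trans (proper_card _) le_k; apply/properP; split.
  by apply/fintype.subsetP => r; rewrite inE => /andP[].
apply: contrapT => /forallPNP ED; apply: nprincipal; exists p; first exact: JD.
by move=> r rD; have /negP/negPn/EP := ED r rD; exact.
Qed.

(** * Homotopies on quotients *)

(* Whitehead's argument: the product of a quotient map with the compact unit
   interval is again a quotient map. *)
Lemma within_continuous_quotient_homotopy (R : realType) (Y Z W : topologicalType)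
    (pi : Y -> Z) (A : set Z) (g : R * Z -> W) :
  (forall z, exists y, pi y = z) ->
  (forall B : set Z, open (pi @^-1` B) -> open B) -> open (pi @^-1` A) ->
  {within @unit_int R `*` (pi @^-1` A), continuous (fun w => g (w.1, pi w.2))} ->
  {within @unit_int R `*` A, continuous g}.
Proof.
move=> pi_surj pi_open oA gc; apply/within_continuousP => -[t0 z0] [/= It0 Az0] O.
rewrite nbhsE => -[Q [oQ Qz] QO]; have [y0 y0z] := pi_surj z0.
have [||[J0 G0] [/= /nbhs_ballP[e /= e0 eJ] nG0] JG0] :=
    (within_continuousP _ _).1 gc (t0, y0) _ Q.
- by rewrite /= y0z.
- by rewrite /= y0z; exact: open_nbhs_nbhs.
have e20 : 0 < e / 2 by rewrite divr_gt0.
pose J : set R := @unit_int R `&` closed_ball_ Num.norm t0 (e / 2).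
have JI : J `<=` @unit_int R by move=> t [].
have Jc : compact J.
  by apply: compact_closedI; [exact: unit_int_compact|exact: closed_closed_ball_].
pose G : set Z := A `&` [set z | forall t, J t -> Q (g (t, z))].
have Gz0 : G z0.
  split=> // t [It /= te]; rewrite -y0z; apply: (JG0 (t, y0)).
    split=> /=; last exact: nbhs_singleton nG0.
    apply: eJ; rewrite -ball_normE /ball_ /=; apply: le_lt_trans te _.
    by rewrite ltr_pdivrMr// mulr_natr mulr2n ltrDl.
  by split=> //=; rewrite y0z.
have oG : open G.
  apply: pi_open; rewrite openE => y [Ay Gy].
  have JAc : {within J `*` (pi @^-1` A), continuous (fun w => g (w.1, pi w.2))}.
    by apply: continuous_subspaceW gc => w [/JI].
  have nA : nbhs y (pi @^-1` A) by exact: open_nbhs_nbhs.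
  have tube := within_continuous_tube Jc JAc Ay
    (fun t Jt => open_nbhs_nbhs (conj oQ (Gy t Jt))).
  by apply: filterS2 nA tube => y' Ay' Qy'; split=> // t Jt; exact: Qy'.
exists (ball t0 (e / 2), G).
  by split; [exact: nbhsx_ballx|exact: open_nbhs_nbhs].
move=> [t z] [/= te [Az Gz]] [/= It _]; apply: QO; apply: Gz; split=> //=.
by move: te; rewrite -ball_normE /ball_ /= => /ltW.
Qed.

Lemma within_continuous_sigT (S W : topologicalType) (I : choiceType)
    (X : I -> topologicalType) (A : set (S * {i & X i}))
    (g : S * {i & X i} -> W) :
  (forall i, {within [set w : S * X i | A (w.1, existT X i w.2)],
     continuous (fun w => g (w.1, existT X i w.2))}) ->
  {within A, continuous g}.
Proof.
move=> gc; apply/within_continuousP => -[t [i x]] Atx O gO.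
have /within_continuousP/(_ (t, x) Atx O gO) [[B C] [/= nB nC] BC] := gc i.
exists (B, existT X i @` C); first by split=> //; exact: existT_nbhs.
move=> [t' u] [/= Bt' [x' Cx' <-]] Atx'.
exact: (BC (t', x') (conj Bt' Cx') Atx').
Qed.

(** * The comparison map *)

Lemma dependent_ifP (b : bool) (F : b = true -> bool) :
  (if b as b' return (b = b' -> bool) then fun h => F h else fun=> false) erefl <->
  exists h, F h.
Proof.
case: b F => F; split=> //; [by exists erefl| |by case].
by case=> h; rewrite (eq_irrelevance h erefl).
Qed.

Section Grothendieck.
Context {d dX : Order.disp_t} {P : finPOrderType d} (X : poset_diagram P dX).
Implicit Types u v w : groth_carrier X.

Lemma groth_leP u v : groth_le u v <->
  exists h : (tag u <= tag v)%O, (Defs.pmap X h (tagged u) <= tagged v)%O.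
Proof. exact: dependent_ifP. Qed.

Lemma groth_le_refl : reflexive (@groth_le d P dX X).
Proof. by move=> u; apply/groth_leP; exists (lexx _); rewrite pmap_id. Qed.

Lemma groth_le_trans : transitive (@groth_le d P dX X).
Proof.
move=> v u w /groth_leP[uv le_uv] /groth_leP[vw le_vw]; apply/groth_leP.
exists (le_trans uv vw); rewrite -(@pmap_comp _ _ _ X _ _ _ uv vw).
by apply: le_trans le_vw; exact: pmap_mono.
Qed.

Definition groth_tag (v : nh_hocolim X) : finspace P := tag (v : groth_carrier X).

Lemma groth_tag_continuous : continuous groth_tag.
Proof.
apply/continuous_subspace_setT; apply: homo_downtop_within.
- exact: groth_le_refl.
- exact: groth_le_trans.
- by move=> u v _ _ /groth_leP[].
Qed.

End Grothendieck.

Section HocolimQuotient.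
Local Open Scope quotient_scope.
Context {R : realType} {d : Order.disp_t} {P : finPOrderType d}.
Variable K : top_diagram P.
Local Notation pre := (hocolim_pre R K).
Local Notation hoc := (hocolim R K).
Local Notation quot := (quotient_topology {eq_quot (hocolim_equiv R K)}).
Implicit Types (u v : pre) (z : hoc).

Definition hocolim_pi u : hoc := \pi_quot u.

Definition hocolim_fun (W : Type) (g : pre -> W) z : W := g (@repr _ quot z).

Lemma hocolim_pi_surj z : exists u, hocolim_pi u = z.
Proof. by exists (@repr _ quot z); exact: reprK. Qed.

Lemma hocolim_pi_step u v : hocolim_step u v -> hocolim_pi u = hocolim_pi v.
Proof. by move=> uv; apply/eqmodP/asboolP; exact: rst_step. Qed.

Lemma hocolim_funE (W : Type) (g : pre -> W) u :
  (forall u v, hocolim_step u v -> g u = g v) -> hocolim_fun g (hocolim_pi u) = g u.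
Proof.
move=> g_step; rewrite /hocolim_fun; set v := repr _.
have /eqmodP/asboolP : hocolim_pi v = hocolim_pi u by exact: reprK.
by elim=> [? ? /g_step|//|? ? _ ->|? ? ? _ -> _ ->].
Qed.

Lemma open_hocolim_pi (B : set hoc) : open (hocolim_pi @^-1` B) -> open B.
Proof. by []. Qed.

Lemma hocolim_pi_existT_continuous p :
  continuous (fun x : tobj K p * realization_F R p => hocolim_pi (existT _ p x)).
Proof.
apply/continuous_subspace_setT.
apply: (@continuous_comp_within _ _ _ _
  (fun x : tobj K p * realization_F R p => existT _ p x : pre)).
  exact: pi_continuous.
exact/continuous_subspaceT/existT_continuous.
Qed.

Definition barycentric u : P -> R := val (tagged u).2.

Lemma barycentricP u : order_complex_point (upset (tag u)) (barycentric u).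
Proof. exact: set_mem (valP (tagged u).2). Qed.

Lemma barycentric_continuous p r :
  continuous (fun x : tobj K p * realization_F R p => (val x.2 : P -> R) r).
Proof.
apply/continuous_subspace_setT.
apply: (@continuous_comp_within _ {ptws P -> R} R _
  (fun x : tobj K p * realization_F R p => val x.2) (fun b => b r)).
  exact: (@proj_continuous P (fun=> R)).
apply: (@continuous_comp_within _ (realization_F R p) {ptws P -> R} _ _ val).
  exact: initial_continuous.
by within_continuity.
Qed.

End HocolimQuotient.

Section LeastVertex.
Context {R : realType} {d : Order.disp_t} {P : finPOrderType d}.
Implicit Types (b : P -> R) (m : P).

Definition is_least_vertex b m := b m != 0 /\ forall r, b r != 0 -> (m <= r)%O.

Lemma least_vertex_exists (Q : set P) b :
  order_complex_point Q b -> exists m, is_least_vertex b m.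
Proof.
move=> [_ b1 _ chain].
have [r0 r0b] : exists r, b r != 0.
  apply/existsP; apply: contraT; rewrite negb_exists => /forallP b0.
  move: b1; rewrite big1 => [/esym/eqP|r _]; first by rewrite oner_eq0.
  by apply/eqP; have := b0 r; rewrite negbK.
case: (@extremum_inP _ _ (<=%O : rel P) r0 [pred r | b r != 0] id) => /=.
- by move=> r _; exact: lexx.
- by move=> r s q _ _ _; exact: le_trans.
- by move=> r s; exact: chain.
- exact: r0b.
- by move=> m bm m_le; exists m.
Qed.

Lemma least_vertex_unique b m m' :
  is_least_vertex b m -> is_least_vertex b m' -> m = m'.
Proof. by move=> [m0 mm] [m0' mm']; apply: le_anti; rewrite mm//= mm'. Qed.

End LeastVertex.

Section Comparison.
Context {R : realType} {d dX : Order.disp_t} {P : finPOrderType d}.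
Context {K : top_diagram P} {X : poset_diagram P dX}.
Variable phi : diagram_morphism K X.
Local Notation pre := (hocolim_pre R K).
Implicit Type u v : pre.

Definition least_vertex u : P := projT1 (cid (least_vertex_exists (barycentricP u))).

Lemma least_vertexP u : is_least_vertex (barycentric u) (least_vertex u).
Proof. exact: projT2 (cid (least_vertex_exists (barycentricP u))). Qed.

Lemma tag_le_least_vertex u : (tag u <= least_vertex u)%O.
Proof. by have [_ _ + _] := barycentricP u; apply; case: (least_vertexP u). Qed.

Definition comparison_pre u : nh_hocolim X := existT _ (least_vertex u)
  (dmor phi (least_vertex u) (tmap K (tag_le_least_vertex u) (tagged u).1) : pobj X _).

Lemma comparison_preE u m (h : (tag u <= m)%O) : is_least_vertex (barycentric u) m ->
  comparison_pre u = existT _ m (dmor phi m (tmap K h (tagged u).1) : pobj X m).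
Proof.
move=> um; rewrite /comparison_pre; move: (tag_le_least_vertex u).
rewrite (least_vertex_unique (least_vertexP u) um) => h'.
by rewrite (bool_irrelevance h' h).
Qed.

Lemma comparison_pre_step u v : hocolim_step u v -> comparison_pre u = comparison_pre v.
Proof.
move=> [uv [uvK uvb]]; have vm := least_vertexP v.
have um : is_least_vertex (barycentric u) (least_vertex v) by rewrite /barycentric uvb.
have h := tag_le_least_vertex v; have h' := le_trans uv h.
by rewrite (comparison_preE h' um) (comparison_preE h vm) -uvK (tmap_comp uv h h').
Qed.

Definition comparison : hocolim R K -> nh_hocolim X := hocolim_fun comparison_pre.

Lemma comparison_pi u : comparison (hocolim_pi u) = comparison_pre u.
Proof. exact/hocolim_funE/comparison_pre_step. Qed.

Lemma comparison_pre_le u m (h : (tag u <= m)%O) (y : pobj X m) :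
  barycentric u m != 0 ->
  (dmor phi m (tmap K h (tagged u).1) <= y :> pobj X m)%O ->
  groth_le (comparison_pre u) (existT _ m y : groth_carrier X).
Proof.
move=> um le_y; have [_ /(_ m um) hm] := least_vertexP u.
apply/groth_leP; exists hm => /=.
by rewrite -dmor_nat (tmap_comp _ hm h).
Qed.

Lemma comparison_continuous : continuous comparison.
Proof.
apply/quotient_continuous; rewrite (_ : comparison \o _ = comparison_pre); last first.
  by apply/funext => u; exact: comparison_pi.
suff contq q : continuous (fun x : tobj K q * realization_F R q =>
    comparison_pre (existT _ q x)).
  apply/continuousP => O oO; apply/sigT_openP => q.
  by have /continuousP/(_ O oO) := contq q.
apply/continuous_subspace_setT; apply: within_continuous_downtop => x0 _.
pose u : pre := existT _ q x0; have um := least_vertexP u.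
have near_m : \forall x \near x0, (val x.2 : P -> R) (least_vertex u) != 0.
  apply: (@barycentric_continuous R _ _ K q (least_vertex u) x0 [set r | r != 0]).
  by apply: open_nbhs_nbhs; split; [exact: open_neq|case: um].
have h : (q <= least_vertex u)%O := tag_le_least_vertex u.
pose g (x : tobj K q * realization_F R q) := dmor phi (least_vertex u) (tmap K h x.1).
have gc : {within setT, continuous g}.
  apply: (continuous_comp_within (@dmor_cont _ _ _ _ _ phi (least_vertex u))).
  by apply: (continuous_comp_within (@tmap_cont _ _ K _ _ h)); within_continuity.
have near_le := near_downtop_le (@le_refl _ _) (@le_trans _ _) gc (I : setT x0).
apply: filterS2 near_m near_le => x xm x_le _.
rewrite (@comparison_preE u _ h um).
by apply: (@comparison_pre_le (existT _ q x) _ h) => //; exact: x_le.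
Qed.

End Comparison.

(** * Deformation onto a principal down-set *)

Section Halves.
Context {R : realType}.
Implicit Type t : R.

Definition first_half t : R := Num.min 1 (2 * t).
Definition second_half t : R := Num.max 0 (2 * t - 1).

Lemma first_half_unit t : unit_int t -> unit_int (first_half t).
Proof.
move=> /andP[t0 t1]; rewrite /unit_int /= /first_half le_min ge_min lexx ler01 /=.
by rewrite andbT; lra.
Qed.

Lemma second_half_unit t : unit_int t -> unit_int (second_half t).
Proof.
move=> /andP[t0 t1]; rewrite /unit_int /= /second_half le_max ge_max lexx ler01 /=.
by lra.
Qed.

Lemma halves_consecutive t : second_half t = 0 \/ first_half t = 1.
Proof.
rewrite /second_half /first_half; have [t2|t2] := leP t 2^-1.
  by left; rewrite max_l//; lra.
by right; rewrite min_l//; lra.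
Qed.

End Halves.

(* The mass of [b] outside the down-set of [p] is scaled by [1 - u], the mass
   inside it is moved to [p] with weight [v]. The second stage may only start
   when the first is completed, or the support would not be a chain. *)
Section PushToVertex.
Context {R : realType} {d : Order.disp_t} {P : finPOrderType d} (p : P).
Implicit Types (b : P -> R) (r s : P).

Definition meets_down b := exists2 r, (r <= p)%O & b r != 0.

Definition vertex_point r : R := (r == p)%:R.

Definition push_mass (u v : R) b r : R :=
  b r * (1 - (if (r <= p)%O then v else u)) + vertex_point r * v.

Definition push_to_vertex (u v : R) b r : R :=
  (\sum_s push_mass u v b s)^-1 * push_mass u v b r.

Lemma vertex_point_sum : \sum_r vertex_point r = 1.
Proof.
rewrite (bigD1 p)//= /vertex_point eqxx big1 ?addr0// => s /negbTE ->.
by [].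
Qed.

Lemma vertex_point_neq0 r : (vertex_point r != 0) = (r == p).
Proof. by rewrite /vertex_point pnatr_eq0 eqb0 negbK. Qed.

Lemma order_complex_vertex (Q : set P) : Q p -> order_complex_point Q vertex_point.
Proof.
move=> Qp; split=> [r||r|r s]; rewrite ?vertex_point_neq0 ?ler0n//.
- exact: vertex_point_sum.
- by move=> /eqP ->.
- by move=> /eqP -> /eqP ->; rewrite lexx.
Qed.

Lemma push_to_vertex0 (Q : set P) b :
  order_complex_point Q b -> push_to_vertex 0 0 b = b.
Proof.
move=> [_ b1 _ _].
have mass0 r : push_mass 0 0 b r = b r.
  by rewrite /push_mass if_same subr0 mulr1 mulr0 addr0.
apply/funext => r; rewrite /push_to_vertex mass0 (eq_bigr _ (fun s _ => mass0 s)).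
by rewrite b1 invr1 mul1r.
Qed.

Lemma push_to_vertex1 b : push_to_vertex 1 1 b = vertex_point.
Proof.
have mass1 r : push_mass 1 1 b r = vertex_point r.
  by rewrite /push_mass if_same subrr mulr0 add0r mulr1.
apply/funext => r; rewrite /push_to_vertex mass1 (eq_bigr _ (fun s _ => mass1 s)).
by rewrite vertex_point_sum invr1 mul1r.
Qed.

Section Stages.
Variables (Q : set P) (u v : R) (b : P -> R).
Hypotheses (u01 : unit_int u) (v01 : unit_int v) (uv : v = 0 \/ u = 1).
Hypotheses (bQ : order_complex_point Q b) (b_down : meets_down b).

Let b_ge0 r : 0 <= b r. Proof. by case: bQ. Qed.

Lemma push_mass_ge0 r : 0 <= push_mass u v b r.
Proof.
move: u01 v01 => /andP[u0 u1] /andP[v0 v1].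
by rewrite addr_ge0// mulr_ge0// ?ler0n//; case: ifP => _; lra.
Qed.

Lemma push_mass_gt0 : exists2 r, (r <= p)%O & 0 < push_mass u v b r.
Proof.
move: v01 => /andP[v0 v1]; have [r rp r0] := b_down.
have [v_1|v_1] := eqVneq v 1.
  exists p; rewrite // /push_mass lexx v_1 subrr mulr0 add0r.
  by rewrite /vertex_point eqxx mulr1.
exists r; rewrite // /push_mass rp ltr_wpDr ?mulr_ge0 ?ler0n// mulr_gt0//.
  by rewrite lt_neqAle eq_sym r0 b_ge0.
by rewrite subr_gt0 lt_neqAle v_1.
Qed.

Lemma push_mass_sum_gt0 : 0 < \sum_s push_mass u v b s.
Proof.
have [r _ r0] := push_mass_gt0; rewrite (bigD1 r)//= ltr_wpDr//.
by apply: sumr_ge0 => s _; exact: push_mass_ge0.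
Qed.

Lemma push_to_vertex_neq0 r : (push_to_vertex u v b r != 0) = (push_mass u v b r != 0).
Proof. by rewrite /push_to_vertex mulf_eq0 invr_eq0 (gt_eqF push_mass_sum_gt0). Qed.

Lemma meets_down_push : meets_down (push_to_vertex u v b).
Proof.
by have [r rp r0] := push_mass_gt0; exists r; rewrite // push_to_vertex_neq0 gt_eqF.
Qed.

Lemma push_support r : push_to_vertex u v b r != 0 ->
  (b r != 0 /\ ((r <= p)%O \/ u != 1)) \/ (r = p /\ v != 0).
Proof.
rewrite push_to_vertex_neq0 /push_mass; have [->|b0] := eqVneq (b r) 0.
  by rewrite mul0r add0r mulf_eq0 negb_or vertex_point_neq0 => /andP[/eqP ? ?]; right.
have [rp|rp] := boolP (r <= p)%O; first by left; split=> //; left.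
have /eqP-> : vertex_point r == 0.
  by rewrite -[_ == _]negbK vertex_point_neq0; apply: contraNN rp => /eqP ->.
rewrite mul0r addr0 mulf_eq0 negb_or subr_eq0 => /andP[_] /=.
by rewrite eq_sym => u1; left; split=> //; right.
Qed.

Lemma order_complex_push : Q p -> order_complex_point Q (push_to_vertex u v b).
Proof.
move=> Qp; have [_ _ b_Q chain] := bQ.
have v0_u1 : v != 0 -> u = 1 by case: uv => [->|//]; rewrite eqxx.
split=> [r||r|r s].
- by rewrite mulr_ge0 ?push_mass_ge0// invr_ge0 ltW// push_mass_sum_gt0.
- by rewrite -mulr_sumr mulVf// gt_eqF// push_mass_sum_gt0.
- by move=> /push_support[[r0 _]|[-> _]] //; exact: b_Q.
- move=> /push_support[[r0 rp]|[-> v0]] /push_support[[s0 sp]|[-> v0']].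
  + exact: chain.
  + by case: rp => [->//|]; rewrite v0_u1// eqxx.
  + by case: sp => [->|]; [rewrite orbT|rewrite v0_u1// eqxx].
  + by rewrite lexx.
Qed.

End Stages.

End PushToVertex.

Section OverPrincipalDownset.
Context {R : realType} {d dX : Order.disp_t} {P : finPOrderType d}.
Context {K : top_diagram P} {X : poset_diagram P dX}.
Variables (phi : diagram_morphism K X) (p : P).
Local Notation pre := (hocolim_pre R K).
Local Notation hoc := (hocolim R K).
Local Notation nh := (nh_hocolim X).
Local Notation comparison := (@comparison R _ _ _ _ _ phi).
Implicit Types (u v : pre) (t : R).

Definition nh_hocolim_below : set nh :=
  @groth_tag _ _ _ X @^-1` [set r : P | (r <= p)%O].
Let over : set hoc := comparison @^-1` nh_hocolim_below.

Lemma over_pi u : over (hocolim_pi u) <-> meets_down p (barycentric u).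
Proof.
change ((groth_tag (comparison (hocolim_pi u)) <= p)%O <->
  meets_down p (barycentric u)).
rewrite comparison_pi /groth_tag /=.
have [um u_min] := least_vertexP u; split=> [mp|[r rp ur]].
  by exists (least_vertex u).
exact: le_trans (u_min r ur) rp.
Qed.

Lemma open_over : open over.
Proof.
apply: open_comp => [z _|]; first exact: comparison_continuous.
apply: open_comp => [v _|]; first exact: groth_tag_continuous.
by apply: downtop_open => r s sr rp; exact: le_trans rp.
Qed.

Lemma meets_down_le q (b : P -> R) :
  order_complex_point (upset q) b -> meets_down p b -> (q <= p)%O.
Proof. by move=> [_ _ bq _] [r rp /bq qr]; exact: le_trans rp. Qed.

Lemma order_complex_push_at q t (b : realization_F R q) :
  meets_down p (val b) -> unit_int t ->
  order_complex_point (upset q)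
    (push_to_vertex p (first_half t) (second_half t) (val b)).
Proof.
move=> b_down It; have bq := set_mem (valP b).
apply: order_complex_push => //.
- exact: first_half_unit.
- exact: second_half_unit.
- exact: halves_consecutive.
- exact: meets_down_le bq b_down.
Qed.

Definition push_at q t (b : realization_F R q) : realization_F R q :=
  match pselect (meets_down p (val b) /\ unit_int t) with
  | left bt => SigSub (mem_set (order_complex_push_at bt.1 bt.2))
  | right _ => b
  end.

Lemma val_push_at q t (b : realization_F R q) : meets_down p (val b) -> unit_int t ->
  val (push_at t b) =
    push_to_vertex p (first_half t) (second_half t) (val b) :> (P -> R).
Proof. by rewrite /push_at => bl It; case: pselect => // -[]; split. Qed.

Lemma push_at_continuous q : {within
    [set w : R * (tobj K q * realization_F R q) |
      unit_int w.1 /\ meets_down p (val w.2.2)],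
    continuous (fun w => push_at w.1 w.2.2)}.
Proof.
pose dom := [set w : R * (tobj K q * realization_F R q) |
  unit_int w.1 /\ meets_down p (val w.2.2)].
apply: within_continuous_set_type; apply: (@eq_within_continuous _ {ptws P -> R} dom
  (fun w => push_to_vertex p (first_half w.1) (second_half w.1) (val w.2.2))).
  by move=> w [It wl]; rewrite val_push_at.
have mass_cont s : {within dom, continuous
    (fun w => push_mass p (first_half w.1) (second_half w.1) (val w.2.2) s)}.
  have valc : {within dom, continuous (fun w => (val w.2.2 : P -> R) s)}.
    apply: (continuous_comp_within (@barycentric_continuous R d P K q s)).
    by within_continuity.
  by rewrite /push_mass /first_half /second_half; case: (s <= p)%O; within_continuity.
apply: within_continuous_ptws => r; apply: within_continuousM => //.
apply: within_continuousV; last exact: within_continuous_sum.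
move=> [t [k b]] [/= It bl]; rewrite gt_eqF//.
apply: push_mass_sum_gt0 (set_mem (valP b)) bl.
- exact: first_half_unit.
- exact: second_half_unit.
Qed.

Definition push_pre t u : hoc :=
  hocolim_pi (existT _ (tag u) ((tagged u).1, push_at t (tagged u).2)).

Definition push_homotopy (w : R * hoc) : hoc := hocolim_fun (push_pre w.1) w.2.

Lemma push_homotopy_pi t u : push_homotopy (t, hocolim_pi u) = push_pre t u.
Proof.
apply: (hocolim_funE (g := push_pre t)) => {}u v [uv [uvK uvb]].
apply: hocolim_pi_step; exists uv; split=> //; change (val (push_at t (tagged u).2) =
  val (push_at t (tagged v).2) :> (P -> R)).
have [[l It]|n] := pselect (meets_down p (val (tagged u).2) /\ unit_int t).
  by rewrite (val_push_at l It) uvb val_push_at// -uvb.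
rewrite /push_at; case: pselect => // _; case: pselect => // -[l It].
by case: n; rewrite uvb.
Qed.

Definition vertex : realization_F R p :=
  SigSub (mem_set (order_complex_vertex (lexx p : upset p p))).

Definition hocolim_incl (k : tobj K p) : hoc := hocolim_pi (existT _ p (k, vertex)).

Lemma hocolim_incl_continuous : continuous hocolim_incl.
Proof.
apply/continuous_subspace_setT.
apply: (continuous_comp_within (@hocolim_pi_existT_continuous R d P K p)
  (f := fun k => (k, vertex))).
by within_continuity.
Qed.

Definition nh_hocolim_incl (x : finspace (pobj X p)) : nh :=
  existT _ p (x : pobj X p) : groth_carrier X.

Lemma nh_hocolim_incl_continuous : continuous nh_hocolim_incl.
Proof.
apply/continuous_subspace_setT; apply: homo_downtop_within => [|y x z|x y _ _ xy].
- exact: lexx.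
- exact: le_trans.
- by apply/groth_leP; exists (lexx p); rewrite pmap_id.
Qed.

Lemma comparison_incl k : comparison (hocolim_incl k) = nh_hocolim_incl (dmor phi p k).
Proof.
rewrite comparison_pi.
rewrite (@comparison_preE _ _ _ _ _ _ _ (existT _ p (k, vertex)) p (lexx p)).
  by rewrite tmap_id.
split=> [|r]; rewrite /barycentric /= vertex_point_neq0//.
by move=> /eqP ->.
Qed.

Section Retraction.
Variable k0 : tobj K p.

Definition hocolim_retr_pre u : tobj K p :=
  match pselect (meets_down p (barycentric u)) with
  | left l => tmap K (meets_down_le (barycentricP u) l) (tagged u).1
  | right _ => k0
  end.

Lemma hocolim_retr_preE u (h : (tag u <= p)%O) : meets_down p (barycentric u) ->
  hocolim_retr_pre u = tmap K h (tagged u).1.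
Proof.
rewrite /hocolim_retr_pre; case: pselect => // l _; congr (tmap K _ _).
exact: bool_irrelevance.
Qed.

Definition hocolim_retr : hoc -> tobj K p := hocolim_fun hocolim_retr_pre.

Lemma hocolim_retr_pi u : hocolim_retr (hocolim_pi u) = hocolim_retr_pre u.
Proof.
apply: hocolim_funE => {}u v [uv [uvK uvb]].
have bary_uv : barycentric u = barycentric v := uvb.
have [l|l] := pselect (meets_down p (barycentric v)); last first.
  have l' : ~ meets_down p (barycentric u) by rewrite bary_uv.
  by rewrite /hocolim_retr_pre; case: pselect => // _; case: pselect.
have vp := meets_down_le (barycentricP v) l; have up := le_trans uv vp.
rewrite (hocolim_retr_preE up) ?bary_uv// (hocolim_retr_preE vp)//.
by rewrite -uvK (tmap_comp uv vp up).
Qed.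

Lemma hocolim_retr_continuous : {within over, continuous hocolim_retr}.
Proof.
rewrite (continuous_open_subspace _ open_over); apply/(continuous_inP _ open_over).
move=> B oB; apply: open_hocolim_pi; apply/sigT_openP => q.
have [qp|qp] := boolP (q <= p)%O; last first.
  rewrite (_ : _ @^-1` _ = set0); first exact: open0.
  apply/seteqP; split=> // x [/over_pi/(meets_down_le (barycentricP _)) /= h].
  by rewrite h in qp.
pose pi_q (x : tobj K q * realization_F R q) := hocolim_pi (existT _ q x : pre).
pose move_q (x : tobj K q * realization_F R q) := tmap K qp x.1.
rewrite (_ : _ @^-1` _ = pi_q @^-1` over `&` move_q @^-1` B).
  apply: openI.
    apply: open_comp => [x _|]; last exact: open_over.
    exact: hocolim_pi_existT_continuous.
  apply: open_comp => // x _; move: x; apply/continuous_subspace_setT.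
  apply: (continuous_comp_within (@tmap_cont _ _ K _ _ qp)).
  by within_continuity.
have retrE x : over (pi_q x) -> hocolim_retr (pi_q x) = move_q x.
  move=> /over_pi l; rewrite hocolim_retr_pi.
  exact: (@hocolim_retr_preE (existT _ q x)).
by apply/seteqP; split=> x [xl]; rewrite /preimage /= => Bx; split=> //;
  move: Bx; rewrite /preimage /= -/(pi_q x) retrE.
Qed.

Lemma push_homotopy1 z : over z -> push_homotopy (1, z) = hocolim_incl (hocolim_retr z).
Proof.
have [u <-] := hocolim_pi_surj z; move=> /over_pi l.
have up := meets_down_le (barycentricP u) l.
rewrite push_homotopy_pi hocolim_retr_pi (hocolim_retr_preE up)//.
apply: hocolim_pi_step; exists up; split=> //=.
rewrite val_push_at//; last exact: unit_int1.
rewrite /first_half /second_half mulr1 min_l ?ler1n// (_ : 2 - 1 = 1); last lra.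
by rewrite max_r//; exact: push_to_vertex1.
Qed.

Lemma push_homotopy_over :
  homotopy_over over over id (hocolim_incl \o hocolim_retr) push_homotopy.
Proof.
split=> [|z|z zl|t z It]; last 3 first.
- have [[q [k b]] <-] := hocolim_pi_surj z; move=> /over_pi zl.
  rewrite push_homotopy_pi /push_pre /=; congr (hocolim_pi (existT _ q (k, _))).
  apply: val_inj; rewrite val_push_at//; last exact: unit_int0.
  rewrite /first_half /second_half mulr0 min_r// sub0r max_l ?lerN10//.
  exact: push_to_vertex0 (set_mem (valP b)).
- exact: push_homotopy1.
- have [u <-] := hocolim_pi_surj z; rewrite over_pi => zl.
  rewrite push_homotopy_pi; apply/over_pi; rewrite /barycentric /= val_push_at//.
  apply: meets_down_push (set_mem (valP (tagged u).2)) zl.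
  + exact: first_half_unit.
  + exact: second_half_unit.
apply: (@within_continuous_quotient_homotopy _ _ _ _ (@hocolim_pi R d P K)).
- exact: hocolim_pi_surj.
- exact: open_hocolim_pi.
- by apply: open_comp => [u _|]; [exact: pi_continuous|exact: open_over].
apply: (@eq_within_continuous _ _ _ (fun w => push_pre w.1 w.2)).
  by move=> w _; rewrite push_homotopy_pi.
apply: within_continuous_sigT => q.
apply: (continuous_comp_within (@hocolim_pi_existT_continuous R d P K q)
  (f := fun w : R * (tobj K q * realization_F R q) => (w.2.1, push_at w.1 w.2.2))).
within_continuity; apply: continuous_subspaceW (@push_at_continuous q).
by move=> [t x] [/= It /over_pi].
Qed.

Variable x0 : pobj X p.

Definition nh_hocolim_retr (v : nh) : finspace (pobj X p) :=
  match pselect (nh_hocolim_below v) with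
  | left h => Defs.pmap X h (tagged (v : groth_carrier X))
  | right _ => x0
  end.

Lemma nh_hocolim_retrE (v : nh) (h : (tag (v : groth_carrier X) <= p)%O) :
  nh_hocolim_retr v = Defs.pmap X h (tagged (v : groth_carrier X)).
Proof.
rewrite /nh_hocolim_retr; case: pselect => // h'.
by rewrite (bool_irrelevance h' h).
Qed.

Lemma nh_hocolim_inclK : cancel nh_hocolim_incl nh_hocolim_retr.
Proof.
by move=> x; rewrite (@nh_hocolim_retrE (nh_hocolim_incl x) (lexx p)) pmap_id.
Qed.

Lemma nh_hocolim_retr_continuous :
  {within nh_hocolim_below, continuous nh_hocolim_retr}.
Proof.
apply: homo_downtop_within => [||v w vp wp /groth_leP[h vw]].
- exact: groth_le_refl.
- exact: groth_le_trans.
- rewrite (nh_hocolim_retrE vp) (nh_hocolim_retrE wp).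
  by rewrite -(@pmap_comp _ _ _ X _ _ _ h wp vp); exact: pmap_mono.
Qed.

Lemma groth_le_incl_retr (v : nh) : nh_hocolim_below v ->
  groth_le v (nh_hocolim_incl (nh_hocolim_retr v)).
Proof. by move=> vp; apply/groth_leP; exists vp; rewrite -(nh_hocolim_retrE vp). Qed.

End Retraction.

Lemma lifting_property_comparison_below :
  weak_homotopy_equivalence R (dmor phi p) ->
  lifting_property R comparison nh_hocolim_below.
Proof.
move=> /weak_equiv_lifting_property phi_lift.
apply: lifting_property_inhabited => v vp.
pose x0 := Defs.pmap X vp (tagged (v : groth_carrier X)).
have [k0] := phi_lift.1 x0 I.
pose j := nh_hocolim_incl; pose s := nh_hocolim_retr x0.
have j_in x : nh_hocolim_below (j x) by rewrite /nh_hocolim_below /=.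
have s_homotopy := @downtop_le_homotopy R _ _ _ nh_hocolim_below
  nh_hocolim_below (j \o s) id (@groth_le_refl _ _ _ X) (@groth_le_trans _ _ _ X).
apply: (@lifting_property_deformation R _ _ _ _ _ nh_hocolim_below _ _ _
  push_homotopy _ _ _
  (@comparison_continuous _ _ _ _ _ _ phi) hocolim_incl_continuous
  nh_hocolim_incl_continuous (@hocolim_retr_continuous k0)
  (@nh_hocolim_retr_continuous x0) comparison_incl (nh_hocolim_inclK x0)
  (push_homotopy_over k0) (s_homotopy _ _ _)) => //.
- apply: (continuous_comp_within nh_hocolim_incl_continuous).
  exact: nh_hocolim_retr_continuous.
- by within_continuity.
- by move=> w wp; split=> //=; exact: groth_le_incl_retr.
- by move=> t y _; rewrite /= /s nh_hocolim_inclK if_same.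
Qed.

End OverPrincipalDownset.

Theorem theorem3p1 (R : realType) (d : Order.disp_t) (P : finPOrderType d)
  (dX : Order.disp_t) (K : top_diagram P) (X : poset_diagram P dX)
  (phi : diagram_morphism K X)
  (phi_weq : forall p : P, weak_homotopy_equivalence R (dmor phi p)) :
  exists phihat : hocolim R K -> nh_hocolim X,
    weak_homotopy_equivalence R phihat.
Proof.
exists (comparison phi); apply: lifting_property_weak_equiv.
  apply: (lifting_property_principal_downsets (@groth_tag_continuous _ _ _ X)) => p.
  exact: lifting_property_comparison_below.
exact: comparison_continuous.
Qed.
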